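(* Let $\Phi$ be a stationary point process in $\mathbb{R}^d$ of unit intensity such that for every $j\ge1$ the joint intensity $\rho^{(j)}$ is almost everywhere continuous. Let $r_n^d\to\beta\in(0,\infty)$. Assume further that $\tilde\gamma_\beta(\Phi,\tilde\Gamma_{k+2})>0$ for all $k\in\{1,\ldots,d-1\}$ and $\gamma_\beta(\Phi,O_k)>0$ for all $k\ge1$. Then for all $k\ge0$, $$\mathbb{E}\{\beta_k(R(\Phi_n,r_n))\}=\Theta(n),$$ and for all $k\in\{0,\ldots,d-1\}$, $$\mathbb{E}\{\beta_k(C(\Phi_n,r_n))\}=\Theta(n).$$
   Context: A point process $\Phi$ in $\mathbb{R}^d$ is a random locally finite counting measure, identified with its random set of points; $\Phi(B)$ is the number of points in $B$. $\Phi^{(k)}$ is the set of ordered $k$-tuples of pairwise distinct points of $\Phi$; the $k$th joint intensity $\rho^{(k)}$ is the Lebesgue density of the intensity measure $\alpha^{(k)}$ of $\Phi^{(k)}$. Standing assumptions: point processes are simple and all joint intensities exist. Stationary means translation invariant in law; unit intensity means $\rho^{(1)}\equiv1$. The reduced Palm distribution $\mathbb{P}^!_{\mathbf{x}}$ at $\mathbf{x}=(x_1,\ldots,x_k)$ is determined, for $\alpha^{(k)}$-a.e. $\mathbf{x}$, by $\mathbb{E}\{\sum_{X\in\Phi^{(k)}}u(\Phi,X)\}=\int\mathbb{E}^!_{\mathbf{x}}\{u(\Phi\cup\{x_1,\ldots,x_k\},\mathbf{x})\}\rho^{(k)}(\mathbf{x})\,d\mathbf{x}$ for bounded measurable $u\ge0$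 with compact support in the second variable (translation-covariant version). $W_n=[-n^{1/d}/2,n^{1/d}/2]^d$, $\Phi_n=\Phi\cap W_n$; $B_x(r)$ is the ball of radius $r$ centred at $x$, $B_{\mathbf{x}}(r)=\bigcup_iB_{x_i}(r)$. For a finite point set $P$ and $\varepsilon>0$, the Čech complex $C(P,\varepsilon)$ has as $m$-simplices the subsets $\{x_{i_0},\ldots,x_{i_m}\}\subset P$ with $\bigcap_l B_{x_{i_l}}(\varepsilon/2)\ne\varnothing$; the Vietoris–Rips complex $R(P,\varepsilon)$ has as $m$-simplices those with $B_{x_{i_l}}(\varepsilon/2)\cap B_{x_{i_{l'}}}(\varepsilon/2)\neq\varnothing$ for all pairs. $\beta_k$ is the $k$th Betti number (homology over $\mathbb{Z}_2$). The geometric graph $G(P,r)$ has vertex set $P$ and edges between distinct points at distance $\le r$. $O_k$ is the graph on $2k+2$ vertices $\pm e_1,\ldots,\pm e_{k+1}$, all pairs being adjacent except antipodal ones. $\tilde\Gamma_j$ is the abstract simplicial complex on $j$ vertices in which every $j-1$ vertices form a face but the set of all $j$ vertices is not a face. For a connected graph $\Gamma$ on $j\ge2$ vertices and a complex $\Delta$ on $j\ge2$ vertices with connected $1$-skeleton, with $\mathbf{y}=(0,y_2,\ldots,y_j)$, $d\mathbf{y}=dy_2\cdots dy_j$ and $q(\mathbf{y})=\rho^{(j)}(\beta^{1/d}\mathbf{y})\,\mathbb{P}^!_{\beta^{1/d}\mathbf{y}}\{\Phi(B_{\beta^{1/d}\mathbf{y}}(\beta^{1/d}))=0\}$, $$\gamma_\beta(\Phi,\Gamma)=\frac{\beta^{j-1}}{j!}\int_{\mathbb{R}^{d(j-1)}}\mathbf{1}[G(\{0,y_2,\ldots,y_j\},1)\simeq\Gamma]\,q(\mathbf{y})\,d\mathbf{y},$$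 $$\tilde\gamma_\beta(\Phi,\Delta)=\frac{\beta^{j-1}}{j!}\int_{\mathbb{R}^{d(j-1)}}\mathbf{1}[C(\{0,y_2,\ldots,y_j\},1)\simeq\Delta]\,q(\mathbf{y})\,d\mathbf{y}.$$ $a_n=\Theta(b_n)$ means $c\,b_n<a_n<C\,b_n$ for some $c,C>0$ and all large $n$. *)

(* Defs.v *)
From HB Require Import structures.
From mathcomp Require Import all_boot all_order all_algebra finmap.
From mathcomp Require Import all_classical all_reals all_analysis.
(* not re-exported by all_analysis; it makes [\bar R] a measurableType *)
From mathcomp Require Import measurable_realfun.

Set Implicit Arguments.
Unset Strict Implicit.
Unset Printing Implicit Defensive.

Import Order.TTheory GRing.Theory Num.Theory.
Import numFieldTopology.Exports numFieldNormedType.Exports.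

Local Open Scope classical_set_scope.
Local Open Scope ring_scope.

(*  A point of R^d is a row vector ['rV[R]_d] and a k-tuple of points is a
    k x d matrix, whose rows are the points.  The library's norm on matrices is
    the sup norm: it is only used for topology and boundedness, distances
    between points being measured by [edist] below. *)

Definition mx_display : measure_display -> measure_display.
Proof. exact. Qed.

Definition mx_coord (T : Type) (m n : nat) (ij : 'I_m * 'I_n)
  (M : 'M[T]_(m, n)) : T := M ij.1 ij.2.

Definition mx_measurable d (T : measurableType d) (m n : nat) :
    set_system 'M[T]_(m, n) :=
  <<s \bigcup_(ij in [set: 'I_m * 'I_n])
        preimage_set_system setT (@mx_coord T m n ij) measurable >>.

Section mx_measurableType.
Context d (T : measurableType d) (m n : nat).

Let mx_measurable0 : @mx_measurable d T m n set0.
Proof. exact: sigma_algebra0. Qed.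

Let mx_measurableC A : @mx_measurable d T m n A -> mx_measurable (~` A).
Proof. exact: sigma_algebraC. Qed.

Let mx_measurable_bigcup (F : (set 'M[T]_(m, n))^nat) :
  (forall i, mx_measurable (F i)) -> mx_measurable (\bigcup_i F i).
Proof. exact: sigma_algebra_bigcup. Qed.

HB.instance Definition _ := @isMeasurable.Build (mx_display d) 'M[T]_(m, n)
  (@mx_measurable d T m n) mx_measurable0 mx_measurableC mx_measurable_bigcup.

End mx_measurableType.

Lemma measurable_coord d (T : measurableType d) m n (i : 'I_m) (j : 'I_n) :
  measurable_fun [set: 'M[T]_(m, n)] (fun M => M i j).
Proof.
move=> _ Y mY; rewrite setTI; apply: sub_sigma_algebra.
by exists (i, j) => //; exists Y => //; rewrite setTI.
Qed.

Lemma measurable_mxP d1 d2 (T1 : measurableType d1) (T2 : measurableType d2)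
    m n (f : T1 -> 'M[T2]_(m, n)) :
  (forall i j, measurable_fun [set: T1] (fun x => f x i j)) ->
  measurable_fun [set: T1] f.
Proof.
move=> mf; apply: (@measurability _ _ _ _ _ _ (\bigcup_(ij in
  [set: 'I_m * 'I_n]) preimage_set_system setT (@mx_coord T2 m n ij)
  measurable)) => //.
move=> _ [_ [[i j] _ [B mB <-]] <-].
rewrite [X in measurable X](_ : _ = setT `&` (fun x => f x i j) @^-1` B).
  exact: mf.
by rewrite !setTI.
Qed.

(* [pushforward mu f], with the sigma-finiteness that it inherits from [mu]
   when [f] has a measurable left inverse. *)
Definition iso_image d1 d2 (T1 : measurableType d1) (T2 : measurableType d2)
    (R : realType) (mu : {sigma_finite_measure set T1 -> \bar R})
    (f : T1 -> T2) (g : T2 -> T1) (mf : measurable_fun setT f)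
    (mg : measurable_fun setT g) (fK : cancel f g) : set T2 -> \bar R :=
  pushforward mu f.

Section iso_image_measure.
Context d1 d2 (T1 : measurableType d1) (T2 : measurableType d2) (R : realType).
Variables (mu : {sigma_finite_measure set T1 -> \bar R}).
Variables (f : T1 -> T2) (g : T2 -> T1).
Hypotheses (mf : measurable_fun setT f) (mg : measurable_fun setT g).
Hypothesis fK : cancel f g.

Local Notation image := (iso_image mu mf mg fK).

Let image0 : image set0 = 0%E.
Proof. by rewrite /iso_image /pushforward preimage_set0 measure0. Qed.

Let image_ge0 A : (0 <= image A)%E.
Proof. exact: measure_ge0. Qed.

Let image_sigma_additive : semi_sigma_additive image.
Proof.
move=> F mF tF mUF; rewrite /iso_image /pushforward preimage_bigcup.
apply: measure_semi_sigma_additive.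
- by move=> n; rewrite -[X in measurable X]setTI; exact: mf.
- apply/trivIsetP => /= i j _ _ ij; rewrite -preimage_setI.
  by move/trivIsetP : tF => /(_ _ _ _ _ ij) ->//; rewrite preimage_set0.
- by rewrite -preimage_bigcup -[X in measurable X]setTI; exact: mf.
Qed.

HB.instance Definition _ := isMeasure.Build _ _ _ image
  image0 image_ge0 image_sigma_additive.

Let image_sigma_finite : sigma_finite setT image.
Proof.
have [F FT Foo] := sigma_finiteT mu.
exists (fun n => g @^-1` (F n)); first by rewrite -preimage_bigcup -FT.
move=> n; have [mF Fn] := Foo n; split.
  by rewrite -[X in measurable X]setTI; exact: mg.
rewrite /iso_image /pushforward [X in mu X](_ : _ = F n)//.
by apply/seteqP; split => x /=; rewrite fK.
Qed.

HB.instance Definition _ := Measure_isSigmaFinite.Build _ _ _ image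
  image_sigma_finite.

End iso_image_measure.

(* The library's product, under its own name: its sigma-finiteness is not found
   on [\x] itself, whose canonical instance is the one for subprobabilities. *)
Definition pair_measure d1 d2 (T1 : measurableType d1) (T2 : measurableType d2)
    (R : realType) (m1 : {sigma_finite_measure set T1 -> \bar R})
    (m2 : {sigma_finite_measure set T2 -> \bar R}) : set (T1 * T2) -> \bar R :=
  (m1 \x m2)%E.

Section pair_measure_sigma_finite.
Context d1 d2 (T1 : measurableType d1) (T2 : measurableType d2) (R : realType).
Variable m1 : {sigma_finite_measure set T1 -> \bar R}.
Variable m2 : {sigma_finite_measure set T2 -> \bar R}.

HB.instance Definition _ := Measure.copy (pair_measure m1 m2) (m1 \x m2)%E.

Let pair_sigma_finite : sigma_finite setT (pair_measure m1 m2).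
Proof.
have /sigma_finiteP[F [TF ndF Foo]] := sigma_finiteT m1.
have /sigma_finiteP[G [TG ndG Goo]] := sigma_finiteT m2.
exists (fun n => F n `*` G n).
  rewrite -setXTT TF TG predeqE => -[x y]; split.
    move=> [/= [n _ Fnx] [k _ Gky]]; exists (maxn n k) => //; split.
    - by move: x Fnx; exact/subsetPset/ndF/leq_maxl.
    - by move: y Gky; exact/subsetPset/ndG/leq_maxr.
  by move=> [n _ []/= ? ?]; split; exists n.
move=> k; have [? ?] := Foo k; have [? ?] := Goo k.
split; first exact: measurableX.
by rewrite /pair_measure product_measure1E// lte_mul_pinfty// ge0_fin_numE.
Qed.

HB.instance Definition _ := Measure_isSigmaFinite.Build _ _ _
  (pair_measure m1 m2) pair_sigma_finite.

End pair_measure_sigma_finite.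

Section tuple_measure.
Context d (T : measurableType d) (R : realType).
Variable mu : {sigma_finite_measure set T -> \bar R}.

Definition cons_tuple n (p : T * n.-tuple T) : n.+1.-tuple T :=
  [tuple of p.1 :: p.2].

Definition uncons_tuple n (t : n.+1.-tuple T) : T * n.-tuple T :=
  (tnth t ord0, [tuple of behead t]).

Lemma measurable_cons_tuple n : measurable_fun setT (@cons_tuple n).
Proof. exact: measurable_cons. Qed.

Lemma measurable_uncons_tuple n : measurable_fun setT (@uncons_tuple n).
Proof.
by apply: measurable_fun_pair; [exact: measurable_tnth|exact: measurable_behead].
Qed.

Lemma cons_tupleK n : cancel (@cons_tuple n) (@uncons_tuple n).
Proof. by case=> x t; congr pair; exact: val_inj. Qed.

Fixpoint tuple_measure n : {sigma_finite_measure set (n.-tuple T) -> \bar R} :=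
  match n with
  | 0 => dirac ([tuple] : 0.-tuple T)
  | n'.+1 => iso_image (pair_measure mu (tuple_measure n')) (@measurable_cons_tuple n')
                       (@measurable_uncons_tuple n') (@cons_tupleK n')
  end.

End tuple_measure.

Section mx_lebesgue.
Variable R : realType.

Definition row_of_tuple d (t : d.-tuple (measurableTypeR R)) : 'rV[R]_d :=
  \row_i tnth t i.

Definition tuple_of_row d (v : 'rV[R]_d) : d.-tuple (measurableTypeR R) :=
  [tuple v 0 i | i < d].

Lemma measurable_row_of_tuple d : measurable_fun setT (@row_of_tuple d).
Proof.
apply: measurable_mxP => i j; under eq_fun do rewrite mxE.
exact: measurable_tnth.
Qed.

Lemma measurable_tuple_of_row d : measurable_fun setT (@tuple_of_row d).
Proof.
apply/measurable_fun_tnthP => i.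
rewrite [X in measurable_fun _ X](_ : _ = fun v : 'rV[R]_d => v 0 i).
  exact: measurable_coord.
by apply/funext => v /=; rewrite tnth_mktuple.
Qed.

Lemma row_of_tupleK d : cancel (@row_of_tuple d) (@tuple_of_row d).
Proof. by move=> t; apply: eq_from_tnth => i; rewrite tnth_mktuple mxE. Qed.

Definition rv_lebesgue d : {sigma_finite_measure set 'rV[R]_d -> \bar R} :=
  iso_image (tuple_measure (@lebesgue_measure R) d) (@measurable_row_of_tuple d)
            (@measurable_tuple_of_row d) (@row_of_tupleK d).

Definition mx_of_tuple k d (t : k.-tuple 'rV[R]_d) : 'M[R]_(k, d) :=
  \matrix_(i, j) tnth t i 0 j.

Definition tuple_of_mx k d (x : 'M[R]_(k, d)) : k.-tuple 'rV[R]_d :=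
  [tuple row i x | i < k].

Lemma measurable_mx_of_tuple k d : measurable_fun setT (@mx_of_tuple k d).
Proof.
apply: measurable_mxP => i j; under eq_fun do rewrite mxE.
apply: (measurableT_comp (measurable_coord 0 j)).
exact: measurable_tnth.
Qed.

Lemma measurable_tuple_of_mx k d : measurable_fun setT (@tuple_of_mx k d).
Proof.
apply/measurable_fun_tnthP => i.
rewrite [X in measurable_fun _ X](_ : _ = row i); last first.
  by apply/funext => x /=; rewrite tnth_mktuple.
apply: measurable_mxP => l j; under eq_fun do rewrite mxE.
exact: measurable_coord.
Qed.

Lemma mx_of_tupleK k d : cancel (@mx_of_tuple k d) (@tuple_of_mx k d).
Proof.
move=> t; apply: eq_from_tnth => i; rewrite tnth_mktuple.
by apply/rowP => j; rewrite !mxE.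
Qed.

Definition mx_lebesgue k d : {sigma_finite_measure set 'M[R]_(k, d) -> \bar R} :=
  iso_image (tuple_measure (@rv_lebesgue d) k) (@measurable_mx_of_tuple k d)
            (@measurable_tuple_of_mx k d) (@mx_of_tupleK k d).

End mx_lebesgue.

Section configurations.
Variables (R : realType) (d : nat).

Definition locally_finite (A : set 'rV[R]_d) : Prop :=
  forall B : set 'rV[R]_d, bounded_set B -> finite_set (A `&` B).

(* A simple locally finite counting measure, as its set of atoms. *)
Record config := Config {
  config_points :> set 'rV[R]_d ;
  config_locally_finite : locally_finite config_points }.

Lemma locally_finite0 : locally_finite set0.
Proof. by move=> B _; rewrite set0I; exact: finite_set0. Qed.

HB.instance Definition _ := gen_eqMixin config.
HB.instance Definition _ := gen_choiceMixin config.
HB.instance Definition _ := isPointed.Build config (Config locally_finite0).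

Definition config_count (C : config) (B : set 'rV[R]_d) : \bar R :=
  counting (C `&` B).

Definition config_measurable : set_system config :=
  <<s \bigcup_(B in measurable)
        preimage_set_system setT (config_count ^~ B) measurable >>.

Let config_measurable0 : config_measurable set0.
Proof. exact: sigma_algebra0. Qed.

Let config_measurableC A : config_measurable A -> config_measurable (~` A).
Proof. exact: sigma_algebraC. Qed.

Let config_measurable_bigcup (F : (set config)^nat) :
  (forall i, config_measurable (F i)) -> config_measurable (\bigcup_i F i).
Proof. exact: sigma_algebra_bigcup. Qed.

Definition config_display : measure_display.
Proof. exact. Qed.

HB.instance Definition _ := @isMeasurable.Build config_display config
  config_measurable config_measurable0 config_measurableC
  config_measurable_bigcup.

Lemma locally_finite_shift (z : 'rV[R]_d) (C : config) :
  locally_finite [set x + z | x in C].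
Proof.
move=> B bB; suff : finite_set (C `&` [set y - z | y in B]).
  move=> /(finite_image (+%R^~ z)); apply: sub_finite_set.
  move=> _ [[x Cx <-] Bxz]; exists x => //; split=> //.
  by exists (x + z) => //; rewrite addrK.
apply: config_locally_finite; move: bB => [M [Mr MB]].
exists (M + `|z|); split; first by rewrite num_real.
move=> N MN _ [y By <-]; rewrite /= (le_trans (ler_normB _ _))//.
by rewrite -lerBrDr; apply: MB => //; rewrite ltrBrDr.
Qed.

Definition shift_config (z : 'rV[R]_d) (C : config) : config :=
  Config (locally_finite_shift z C).

Definition shift_tuple k (z : 'rV[R]_d) (x : 'M[R]_(k, d)) : 'M[R]_(k, d) :=
  \matrix_(i, j) (x i j + z 0 j).

Lemma locally_finite_add k (x : 'M[R]_(k, d)) (C : config) :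
  locally_finite (C `|` range (fun i => row i x)).
Proof.
move=> B bB; rewrite setIUl finite_setU; split.
  exact: config_locally_finite.
by apply: finite_setIl; apply: finite_image; exact: finite_finset.
Qed.

Definition add_points k (C : config) (x : 'M[R]_(k, d)) : config :=
  Config (locally_finite_add x C).

Definition distinct_tuples k (C : config) : set 'M[R]_(k, d) :=
  [set x | (forall i, config_points C (row i x)) /\ injective (fun i => row i x)].

End configurations.
Arguments distinct_tuples {R d} k C.

Section point_processes.
Context (R : realType) (d : nat) (disp : measure_display)
  (Omega : measurableType disp) (P : probability Omega R).
Implicit Types (Phi : {mfun Omega >-> config R d}) (z : 'rV[R]_d).

Definition stationary Phi : Prop := forall z (A : set (config R d)),
  measurable A -> P [set w | A (shift_config z (Phi w))] = P (Phi @^-1` A).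

Definition factorial_moment Phi k (A : set 'M[R]_(k, d)) : \bar R :=
  (\int[P]_w counting (distinct_tuples k (Phi w) `&` A))%E.

(* The moment measures are required to be locally finite, as is usual for
   intensity measures; that is, rho is locally integrable. *)
Definition is_joint_intensity Phi k (rho : 'M[R]_(k, d) -> R) : Prop :=
  [/\ measurable_fun setT rho,
      forall x, 0 <= rho x,
      forall A : set 'M[R]_(k, d), measurable A ->
        factorial_moment Phi A = (\int[mx_lebesgue R k d]_(x in A) (rho x)%:E)%E
    & forall A : set 'M[R]_(k, d), measurable A -> bounded_set A ->
        (factorial_moment Phi A < +oo)%E].

Definition translation_invariant k (rho : 'M[R]_(k, d) -> R) : Prop :=
  forall z x, rho (shift_tuple z x) = rho x.

Definition ae_continuous k (f : 'M[R]_(k, d) -> R) : Prop :=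
  {ae mx_lebesgue R k d, forall x, {for x, continuous f}}.

Definition is_reduced_palm Phi k (rho : 'M[R]_(k, d) -> R)
    (palm : R.-pker 'M[R]_(k, d) ~> config R d) : Prop :=
  forall u : config R d * 'M[R]_(k, d) -> R,
    measurable_fun setT u -> (forall p, 0 <= u p) ->
    (exists M, forall p, u p <= M) ->
    (exists K : set 'M[R]_(k, d), compact K /\
       forall C x, ~ K x -> u (C, x) = 0) ->
  (\int[P]_w (\esum_(x in distinct_tuples k (Phi w)) (u (Phi w, x))%:E) =
   \int[mx_lebesgue R k d]_x
     ((\int[palm x]_C (u (add_points C x, x))%:E) * (rho x)%:E))%E.

Definition translation_covariant k
    (palm : R.-pker 'M[R]_(k, d) ~> config R d) : Prop :=
  forall z x (A : set (config R d)), measurable A ->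
    palm (shift_tuple z x) A = palm x [set C | A (shift_config z C)].

End point_processes.

(* A complex on a finite vertex type is the set of its faces. *)
Notation complex V := {set {set V}}.

Section homology.
Variable V : finType.
Implicit Type K : complex V.

Definition faces K m : {set {set V}} := [set s in K | #|s| == m.+1]%SET.

(* Chains are row vectors indexed by faces, so row [i] is the boundary of the
   [i]-th (m+1)-face; there are no signs over Z_2. *)
Definition boundary K m : 'M['F_2]_(#|faces K m.+1|, #|faces K m|) :=
  \matrix_(i < #|faces K m.+1|, j < #|faces K m|)
    ((enum_val j : {set V}) \subset (enum_val i : {set V}))%:R.

Definition dim_cycles K k : nat :=
  if k is m.+1 then \rank (kermx (boundary K m)) else #|faces K 0|.

(* dim ker - dim im, that is the dimension of the quotient. *)
Definition betti K k : nat := (dim_cycles K k - \rank (boundary K k))%N.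

End homology.

Definition graph_iso (V W : finType) (e : rel V) (f : rel W) : Prop :=
  exists h : V -> W, bijective h /\ forall u v, f (h u) (h v) = e u v.

Definition complex_iso (V W : finType) (K : complex V) (L : complex W) : Prop :=
  exists h : V -> W, bijective h /\
    forall s : {set V}, ((h @: s)%SET \in L) = (s \in K).

(* Vertices are pairs (i, b), standing for +e_i or -e_i. *)
Definition cross_polytope k : rel ('I_k.+1 * bool) :=
  fun u v => u.1 != v.1.
Arguments cross_polytope k : clear implicits.

Definition hollow_simplex j : complex 'I_j :=
  [set s : {set 'I_j} | (s != finset.set0) && (s != finset.setT)]%SET.

Section geometric.
Variables (R : realType) (d : nat).
Implicit Types (x y : 'rV[R]_d) (P : {fset 'rV[R]_d}).

Definition edist x y : R := Num.sqrt (\sum_(i < d) (x 0 i - y 0 i) ^+ 2).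

Definition eball x (r : R) : set 'rV[R]_d := [set y | edist x y <= r].

Definition eball_tuple k (x : 'M[R]_(k, d)) (r : R) : set 'rV[R]_d :=
  \bigcup_(i in [set: 'I_k]) eball (row i x) r.

Definition geometric_graph P (r : R) : rel P :=
  fun u v => (u != v) && (edist (val u) (val v) <= r).

Definition cech P (eps : R) : complex P :=
  [set s : {set P} | (s != finset.set0) &&
    `[< (\bigcap_(u in [set` s]) eball (val u) (eps / 2)) !=set0 >]]%SET.

Definition rips P (eps : R) : complex P :=
  [set s : {set P} | (s != finset.set0) &&
    `[< forall u v, u \in s -> v \in s ->
        (eball (val u) (eps / 2) `&` eball (val v) (eps / 2)) !=set0 >]]%SET.

Definition tuple_points k (x : 'M[R]_(k, d)) : {fset 'rV[R]_d} :=
  [fset row i x | i in 'I_k]%fset.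

Definition window (n : nat) : set 'rV[R]_d :=
  [set x : 'rV[R]_d | forall i, `|x 0 i| <= n%:R `^ d%:R^-1 / 2].

Definition window_points (C : config R d) (n : nat) : {fset 'rV[R]_d} :=
  fset_set (C `&` window n).

End geometric.

Section gamma.
Variables (R : realType) (d : nat).
Variable rho : forall k, 'M[R]_(k, d) -> R.
Variable palm : forall k, R.-pker 'M[R]_(k, d) ~> config R d.
Variable beta : R.

(* The tuple (0, y_2, ..., y_j), with j = m.+1. *)
Definition with_origin m (y : 'M[R]_(m, d)) : 'M[R]_(m.+1, d) :=
  col_mx (0 : 'rV[R]_d) y.

Definition gamma_density m (y : 'M[R]_(m, d)) : \bar R :=
  let b := beta `^ d%:R^-1 in
  let x := b *: with_origin y in
  ((rho x)%:E *
   palm m.+1 x [set C : config R d | C `&` eball_tuple x b = set0])%E.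

Definition gamma_integral m (A : set 'M[R]_(m, d)) : \bar R :=
  ((beta ^+ m / (m.+1)`!%:R)%:E *
   \int[mx_lebesgue R m d]_y ((\1_A y)%:E * gamma_density y))%E.

Definition gamma (V : finType) (G : rel V) : \bar R :=
  gamma_integral [set y : 'M[R]_(#|V|.-1, d) |
    graph_iso (@geometric_graph R d (tuple_points (with_origin y)) 1) G].

Definition gamma_cech (V : finType) (K : complex V) : \bar R :=
  gamma_integral [set y : 'M[R]_(#|V|.-1, d) |
    complex_iso (cech (tuple_points (with_origin y)) 1) K].

End gamma.

Definition big_theta (R : realType) (a : nat -> \bar R) (b : nat -> R) : Prop :=
  exists c C : R, [/\ 0 < c, 0 < C &
    \forall n \near \oo, ((c * b n)%:E < a n < (C * b n)%:E)%E].

(* Main.v *)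
Require Import Defs.
From mathcomp Require Import all_boot all_order all_algebra finmap.
From mathcomp Require Import all_classical all_reals all_analysis.
From mathcomp Require Import measurable_realfun ring lra.

Set Implicit Arguments.
Unset Strict Implicit.
Unset Printing Implicit Defensive.

Import Order.TTheory GRing.Theory Num.Theory.
Import numFieldTopology.Exports numFieldNormedType.Exports.

Local Open Scope classical_set_scope.
Local Open Scope ring_scope.

(** Both expectations are compared with the number of cells of a partition of
    the window into cubes of a fixed side, which is of the order of n.

    Upper bound. A Betti number is at most the number of k-faces, and a face has
    diameter at most r_n, so that it lies in the neighbourhood of the cell of
    any of its vertices ([faces_le_cells]). The number of faces in one such
    neighbourhood is at most a factorial power of the number of points there;
    its expectation is finite because the moment measures are locally finite,
    and does not depend on the cell by stationarity ([expected_betti_le]).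

    Lower bound. Call cluster a group of points of the process that are farther
    than r_n from all the other points. If the complex that they span is a
    k-sphere, then the fundamental cycle of the sphere has value 1 on the
    cochain of one of its k-faces, and this cochain is a cocycle because no
    (k+1)-face contains that k-face. Disjoint clusters give cycles and cocycles
    that are dual to one another, hence the k-th Betti number is at least their
    number ([betti_ge_spheres]). The boundary of a (k+1)-simplex and the
    boundary of the (k+1)-dimensional cross-polytope are such spheres; for k = 0
    a cluster of any shape contributes a connected component.

    It remains to find such a cluster in a given cell with a probability bounded
    below, for all large n. Put b = beta^(1/d), the limit of r_n. Positivity of
    gamma yields a set of positive measure of relative positions y for which
    both the joint intensity and the Palm probability of an empty neighbourhood
    are positive at scale b; by invariance it yields a set of positive measure
    of tuples of points of the space ([mx_lebesgue_relative_rows]). The complex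
    of a tuple at scale r depends only on which groups of balls of radius r / 2
    meet, and this is locally constant in the tuple and in r unless some
    smallest enclosing ball has radius exactly b / 2 ([balls_meet_robust]). Such
    exceptional tuples form a null set: scaling moves the level sets of the
    enclosing radius onto one another, each tuple lies on a single one, and
    Fubini's theorem makes almost all of them null, hence all
    ([critical_null]). The remaining tuples are covered by countably many
    rational neighbourhoods, each with a margin e in position and in scale, so
    one of them keeps positive measure ([cluster_event_gt0]). For that one, the
    Palm formula shows that with positive probability every ball of radius e
    around the centres q_i contains a point and the balls of radius b + 3 e
    around them contain no further point ([palm_cluster_event]). This event is
    expressed by counts only, hence its probability is the same for all
    translates of q, and on it the cluster keeps its shape and its isolation at
    every scale within e of b, in particular at scale r_n for n large
    ([grid_betti_ge], [expected_betti_ge]). *)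

Local Notation edist := Defs.edist.

(** * Betti numbers over the field with two elements *)

Section linear_algebra.
Variable V : finType.
Implicit Types (K : complex V) (s t : {set V}).

Definition hereditary K := forall s t,
  s \in K -> t \subset s -> t != finset.set0 -> t \in K.

Definition isolated K (A : {set V}) := forall s,
  s \in K -> forall v, v \in s -> v \in A -> s \subset A.

Lemma two_eq0_F2 : (2%:R : 'F_2) = 0.
Proof. exact/val_inj. Qed.

Lemma even_eq0_F2 n : ~~ odd n -> (n%:R : 'F_2) = 0.
Proof.
move=> /negbTE nodd; rewrite -(odd_double_half n) nodd add0n -muln2.
by rewrite natrM two_eq0_F2 mulr0.
Qed.

Lemma sum_faces K m (F : {set V} -> 'F_2) :
  \sum_(i < #|faces K m|) F (enum_val i) = \sum_(f in faces K m) F f.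
Proof. by rewrite -big_enum_val. Qed.

Lemma sum_indicator (A : {set {set V}}) (b : pred {set V}) :
  \sum_(f in A) (b f)%:R = #|[set f in A | b f]%SET|%:R :> 'F_2.
Proof.
rewrite -sum1dep_card natr_sum big_mkcondr.
by apply: eq_bigr => f _; case: (b f).
Qed.

(** Such a t is s with one more element of U. With #|U :\: s| = 2 this is the
    parity behind every cycle condition below. *)
Lemma card_intermediate s (U : {set V}) : s \subset U ->
  #|[set t : {set V} | [&& #|t| == #|s|.+1, s \subset t & t \subset U]]%SET| =
  #|U :\: s|%SET.
Proof.
move=> sU; rewrite -(card_in_imset (D := (U :\: s)%SET) (f := fun x => (x |: s)%SET)); last first.
  move=> x y; rewrite !inE => /andP[xs _] /andP[ys _] e.
  have : x \in (y |: s)%SET by rewrite -e !inE eqxx.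
  by rewrite !inE (negbTE xs) orbF => /eqP.
apply: eq_card => t; rewrite !inE; apply/idP/imsetP.
  move=> /and3P[/eqP ct st tU].
  have : #|t :\: s|%SET == 1%N.
    by rewrite cardsD (finset.setIidPr st) ct subSnn.
  move=> /cards1P[x tsx]; exists x.
    have : x \in (t :\: s)%SET by rewrite tsx !inE.
    by rewrite !inE => /andP[-> xt]; exact: (fintype.subsetP tU).
  by rewrite -tsx finset.setUC -{1}(finset.setID t s) (finset.setIidPr st).
move=> [x]; rewrite !inE => /andP[xs xU] ->; apply/and3P; split.
- by rewrite cardsU1 xs.
- exact: finset.subsetUr.
- by rewrite finset.subUset finset.sub1set xU.
Qed.

(** Exactly two faces lie between s and t when t has two more vertices
    than s. *)
Lemma boundary_boundary K m : hereditary K ->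
  boundary K m.+1 *m boundary K m = 0.
Proof.
move=> hK; apply/matrixP => i j; rewrite !mxE.
under eq_bigr do rewrite !mxE.
set t := enum_val i; set s : {set V} := enum_val j.
have /[!inE]/andP[tK /eqP ct] := enum_valP i.
have /[!inE]/andP[sK /eqP cs] := enum_valP j.
rewrite (sum_faces K m.+1 (fun f => (f \subset t)%:R * (s \subset f)%:R)).
under eq_bigr do rewrite -natrM mulnb.
rewrite sum_indicator.
have [st|st] := boolP (s \subset t); last first.
  rewrite (eq_card0 (A := [set _ in _ | _]%SET))// => f; rewrite !inE.
  apply/negP => /andP[_ /andP[ft sf]].
  by rewrite (fintype.subset_trans sf ft) in st.
apply: even_eq0_F2.
have -> : #|[set f in faces K m.+1 | (f \subset t) && (s \subset f)]%SET| =
  #|[set f : {set V} | [&& #|f| == #|s|.+1, s \subset f & f \subset t]]%SET|.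
  apply: eq_card => f; rewrite !inE cs.
  case: (boolP (f \subset t)); rewrite ?andbF//= andbT => ft.
  case: (boolP (s \subset f)); rewrite ?andbF//= !andbT => sf.
  case: (eqVneq #|f| m.+2); rewrite ?andbF// andbT => cf.
  apply: (hK t) => //; rewrite -card_gt0 cf//.
by rewrite card_intermediate// cardsD (finset.setIidPr st) cs ct subSn// subSnn.
Qed.

(** The rows of Z are independent modulo the row space of B, because C kills the
    latter and is dual to the former. With W the cycles, B the boundaries, Z
    cycles and C cocycles, this bounds a Betti number from below. *)
Lemma leq_mxrank_add n p q r (B : 'M['F_2]_(n, p)) (Z : 'M['F_2]_(q, p))
    (C : 'M['F_2]_(p, q)) (W : 'M['F_2]_(r, p)) :
  (B <= W)%MS -> (Z <= W)%MS -> B *m C = 0 -> Z *m C = 1%:M ->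
  (\rank B + q <= \rank W)%N.
Proof.
move=> BW ZW BC ZC.
have rZ : \rank Z = q by apply/eqP/row_freeP; exists C.
have BZ0 : (B :&: Z)%MS = 0.
  apply/eqP; rewrite -submx0.
  have /submxP[U eU] := capmxSl B Z; have /submxP[U' eU'] := capmxSr B Z.
  have : (B :&: Z)%MS *m C = U' by rewrite eU' -mulmxA ZC mulmx1.
  rewrite eU -mulmxA BC mulmx0 => U'0.
  by rewrite -eU eU' -U'0 mul0mx submx0.
rewrite -[in X in (_ + X)%N]rZ -(mxrank_disjoint_sum BZ0).
by apply: mxrankS; rewrite addsmx_sub BW.
Qed.

Lemma betti_le_faces K k : (betti K k <= #|faces K k|)%N.
Proof.
apply: (leq_trans (leq_subr _ _)).
by case: k => [//|k]; exact: rank_leq_row.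
Qed.

(** The cycles are single vertices, one in each cluster, and the cocycles are the
    indicator functions of the clusters: an edge has both of its ends in a
    cluster or none. *)
Lemma betti0_ge_clusters K (I : finType) (A : I -> {set V}) :
  hereditary K -> (forall i, isolated K (A i)) ->
  (forall i j v, v \in A i -> v \in A j -> i = j) ->
  (forall i, exists2 v, v \in A i & [set v]%SET \in K) ->
  (#|I| <= betti K 0)%N.
Proof.
move=> hK iA dA vA.
have /choice[v vP] : forall i, exists v, v \in A i /\ [set v]%SET \in K.
  by move=> i; have [w ? ?] := vA i; exists w.
pose Z : 'M['F_2]_(#|I|, #|faces K 0|) := \matrix_(i, j)
  ((enum_val j : {set V}) == [set v (enum_val i)]%SET)%:R.
pose C : 'M['F_2]_(#|faces K 0|, #|I|) := \matrix_(j, i)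
  ((enum_val j : {set V}) \subset A (enum_val i))%:R.
suff : (\rank (boundary K 0) + #|I| <= #|faces K 0|)%N.
  by rewrite /betti /= => h; rewrite leq_subRL// (leq_trans _ h)// leq_addr.
rewrite -[X in (_ <= X)%N](mxrank1 'F_2).
apply: (@leq_mxrank_add _ _ _ _ (boundary K 0) Z C); rewrite ?submx1//.
- apply/matrixP => i j; rewrite !mxE; under eq_bigr do rewrite !mxE.
  set t : {set V} := enum_val i; set a := enum_val j.
  have /[!inE]/andP[tK /eqP ct] := enum_valP i.
  rewrite (sum_faces K 0 (fun f => (f \subset t)%:R * (f \subset A a)%:R)).
  under eq_bigr do rewrite -natrM mulnb.
  rewrite sum_indicator.
  have [x /andP[xt xA]|tA] := pickP [pred x in t | x \in A a].
    have tAa := iA _ _ tK x xt xA.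
    apply: even_eq0_F2.
    suff -> : [set f in faces K 0 | (f \subset t) && (f \subset A a)]%SET =
        [set [set y]%SET | y in t]%SET.
      by rewrite card_imset ?ct//; exact: finset.set1_inj.
    apply/finset.setP => f; rewrite !inE; apply/idP/imsetP.
      move=> /andP[/andP[_ /cards1P/= [y ->]]].
      by rewrite !finset.sub1set => /andP[yt _]; exists y.
    move=> [y yt ->]; rewrite cards1 !finset.sub1set yt/= (fintype.subsetP tAa)//.
    rewrite !andbT; apply: (hK t) => //; rewrite ?finset.sub1set//.
    by rewrite -card_gt0 cards1.
  rewrite [X in X%:R](_ : _ = 0%N)//; apply: eq_card0 => f; rewrite !inE.
  apply/negP => /andP[/andP[_ /cards1P/= [x ->]]].
  by move: (tA x) => /=; rewrite !finset.sub1set => ->.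
- apply/matrixP => i j; rewrite !mxE; under eq_bigr do rewrite !mxE.
  rewrite (sum_faces K 0 (fun f =>
    (f == [set v (enum_val i)]%SET)%:R * (f \subset A (enum_val j))%:R)).
  have [vi vK] := vP (enum_val i).
  rewrite (bigD1 [set v (enum_val i)]%SET)/=; last by rewrite inE vK cards1.
  rewrite eqxx mul1r big1 ?addr0; last first.
    by move=> f /andP[_ /negbTE ->]; rewrite mul0r.
  rewrite finset.sub1set; congr (nat_of_bool _)%:R.
  apply/idP/eqP => [vj|->//]; last exact: (vP (enum_val j)).1.
  exact/enum_val_inj/(dA _ _ _ vi vj).
Qed.

(** The roles are exchanged with respect to dimension 0: the cycle of a cluster
    is the sum of its top faces, closed by the parity condition, and the cocycle
    is a single top face, closed because no larger face contains it. *)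
Lemma bettiS_ge_clusters K k (I : finType) (A : I -> {set V}) :
  hereditary K -> (forall i, isolated K (A i)) ->
  (forall i j v, v \in A i -> v \in A j -> i = j) ->
  (forall i, exists2 s, s \in K & (s \subset A i) && (#|s| == k.+2)) ->
  (forall i s, s \in K -> s \subset A i -> #|s| != k.+3) ->
  (forall i s, s \in K -> s \subset A i -> #|s| = k.+1 ->
    ~~ odd #|[set t in K | (#|t| == k.+2) && (s \subset t)]%SET|) ->
  (#|I| <= betti K k.+1)%N.
Proof.
move=> hK iA dA topA dimA evenA.
have /choice[v vP] : forall i, exists s,
    [/\ s \in K, s \subset A i & #|s| = k.+2].
  by move=> i; have [s sK /andP[sA /eqP cs]] := topA i; exists s.
have v_gt0 i : exists x, x \in v i.
  by apply/card_gt0P; have [_ _ ->] := vP i.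
pose Z : 'M['F_2]_(#|I|, #|faces K k.+1|) := \matrix_(i, j)
  ((enum_val j : {set V}) \subset A (enum_val i))%:R.
pose C : 'M['F_2]_(#|faces K k.+1|, #|I|) := \matrix_(j, i)
  ((enum_val j : {set V}) == v (enum_val i))%:R.
suff : (\rank (boundary K k.+1) + #|I| <= \rank (kermx (boundary K k)))%N.
  by rewrite /betti /= => h; rewrite leq_subRL// (leq_trans _ h)// leq_addr.
apply: (@leq_mxrank_add _ _ _ _ (boundary K k.+1) Z C).
- by apply/sub_kermxP; exact: boundary_boundary.
- apply/sub_kermxP/matrixP => i j; rewrite !mxE.
  under eq_bigr do rewrite !mxE.
  set a := enum_val i; set s : {set V} := enum_val j.
  have /[!inE]/andP[sK /eqP cs] := enum_valP j.
  rewrite (sum_faces K k.+1 (fun f => (f \subset A a)%:R * (s \subset f)%:R)).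
  under eq_bigr do rewrite -natrM mulnb.
  rewrite sum_indicator.
  have [sA|sA] := boolP (s \subset A a); last first.
    rewrite [X in X%:R](_ : _ = 0%N)//; apply: eq_card0 => f; rewrite !inE.
    apply/negP => /andP[_ /andP[fA sf]].
    by rewrite (fintype.subset_trans sf fA) in sA.
  apply: even_eq0_F2; move: (evenA _ _ sK sA cs); congr (~~ odd _).
  apply: eq_card => f; rewrite !inE.
  case: (boolP (f \in K)) => //= fK; case: (#|f| == _) => //=.
  case: (boolP (s \subset f)); rewrite ?andbF//= andbT => sf.
  have /card_gt0P[x xs] : (0 < #|s|)%N by rewrite cs.
  apply/esym/(iA _ _ fK x); first exact: (fintype.subsetP sf).
  exact: (fintype.subsetP sA).
- apply/matrixP => i j; rewrite !mxE; under eq_bigr do rewrite !mxE.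
  set t : {set V} := enum_val i; set a := enum_val j.
  have /[!inE]/andP[tK ct] := enum_valP i.
  rewrite (sum_faces K k.+1 (fun f => (f \subset t)%:R * (f == v a)%:R)).
  rewrite big1// => f _; have [->|] := eqVneq f (v a); last by rewrite mulr0.
  have [vt|] := boolP (v a \subset t); last by rewrite mul0r.
  have [x xv] := v_gt0 a; have [_ vA _] := vP a.
  have tA : t \subset A a.
    apply: (iA _ _ tK x); first exact: (fintype.subsetP vt).
    exact: (fintype.subsetP vA).
  by move: (dimA _ _ tK tA); rewrite ct.
- apply/matrixP => i j; rewrite !mxE; under eq_bigr do rewrite !mxE.
  rewrite (sum_faces K k.+1 (fun f =>
    (f \subset A (enum_val i))%:R * (f == v (enum_val j))%:R)).
  have [vK vA cv] := vP (enum_val j).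
  rewrite (bigD1 (v (enum_val j)))/=; last by rewrite inE vK cv eqxx.
  rewrite eqxx mulr1 big1 ?addr0; last first.
    by move=> f /andP[_ /negbTE ->]; rewrite mulr0.
  congr (nat_of_bool _)%:R; apply/idP/eqP => [vi|->//].
  have [x xv] := v_gt0 (enum_val j); apply: enum_val_inj.
  by apply: (dA _ _ x); [exact: (fintype.subsetP vi)|exact: (fintype.subsetP vA)].
Qed.

End linear_algebra.

Section spheres.

(** The combinatorial properties of a triangulated k-sphere from which a nonzero
    homology class of degree k is built. *)
Definition spherical (W : finType) (L : complex W) k :=
  [/\ exists2 s, s \in L & #|s| = k.+1,
      forall s, s \in L -> #|s| != k.+2 &
      forall s, s \in L -> #|s| = k ->
        ~~ odd #|[set t in L | (#|t| == k.+1) && (s \subset t)]%SET|].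

Definition embeds (V W : finType) (K : complex V) (L : complex W)
    (g : W -> V) :=
  injective g /\ forall S : {set W}, ((g @: S)%SET \in K) = (S \in L).

(** When all faces of K above the image of S stay in the image of g, they
    correspond to the faces of L above S. *)
Lemma embeds_even (V W : finType) (K : complex V) (L : complex W) (g : W -> V)
    n (S : {set W}) :
  embeds K L g -> (forall t, t \in K -> (g @: S)%SET \subset t ->
    t \subset (g @: finset.setT)%SET) ->
  #|[set t in K | (#|t| == n) && ((g @: S)%SET \subset t)]%SET| =
  #|[set t in L | (#|t| == n) && (S \subset t)]%SET|.
Proof.
move=> [gI gL] tA.
rewrite -(card_imset (mem [set t in L | (#|t| == n) && (S \subset t)]%SET)
  (imset_inj gI)).
apply: eq_card => t; rewrite inE; apply/idP/imsetP.
  move=> /andP[tK /andP[/eqP ct st]].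
  have et : t = (g @: (g @^-1: t))%SET.
    apply/finset.setP => x; apply/idP/imsetP => [xt|[y]]; last first.
      by rewrite inE => ? ->.
    have /imsetP[y _ xy] := fintype.subsetP (tA _ tK st) _ xt.
    by exists y => //; rewrite inE -xy.
  exists (g @^-1: t)%SET => //; rewrite inE -gL -et tK/= -ct {2}et card_imset//.
  rewrite eqxx/=; apply/fintype.subsetP => x xS; rewrite inE.
  by apply: (fintype.subsetP st); exact: imset_f.
move=> [u]; rewrite inE => /andP[uL /andP[cu su]] ->.
by rewrite gL uL card_imset// cu imsetS.
Qed.

Lemma betti_ge_spheres (V W I : finType) (K : complex V) (L : complex W) k
    (g : I -> W -> V) :
  (0 < k)%N -> hereditary K -> spherical L k ->
  (forall i, embeds K L (g i)) ->
  (forall i, isolated K (g i @: finset.setT)%SET) ->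
  (forall i j u v, g i u = g j v -> i = j) ->
  (#|I| <= betti K k)%N.
Proof.
case: k => // k _ hK [[s0 s0L cs0] dimL evenL] gL gA gdisj.
have gE i (s : {set V}) : s \subset (g i @: finset.setT)%SET ->
    s = (g i @: (g i @^-1: s))%SET.
  move=> /fintype.subsetP sA; apply/finset.setP => x.
  apply/idP/imsetP => [xt|[y]]; last by rewrite inE => ? ->.
  have /imsetP[y _ xy] := sA _ xt.
  by exists y => //; rewrite inE -xy.
apply: (bettiS_ge_clusters (A := fun i => (g i @: finset.setT)%SET)) => //.
- move=> i j v /imsetP[u _ ->] /imsetP[u' _]; exact: gdisj.
- move=> i; have [gI gK] := gL i; exists (g i @: s0)%SET; first by rewrite gK.
  by rewrite card_imset// cs0 eqxx imsetS// finset.subsetT.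
- move=> i s sK sA; have [gI gK] := gL i; move: sK; rewrite (gE _ _ sA) gK => sL.
  by rewrite card_imset// dimL.
- move=> i s sK sA; have [gI gK] := gL i; move: sK; rewrite (gE _ _ sA) gK => sL.
  rewrite card_imset// => cs; rewrite (@embeds_even _ _ _ L)//.
    exact: evenL.
  move=> t tK st.
  have /card_gt0P[x xs] : (0 < #|g i @^-1: s|%SET)%N by rewrite cs.
  apply: (gA _ _ tK (g i x)); last by rewrite imset_f.
  by apply: (fintype.subsetP st); exact: imset_f.
Qed.

Lemma betti0_ge_embedded (V W I : finType) (K : complex V) (L : complex W)
    (g : I -> W -> V) (w : W) :
  hereditary K -> [set w]%SET \in L ->
  (forall i, embeds K L (g i)) ->
  (forall i, isolated K (g i @: finset.setT)%SET) ->
  (forall i j u v, g i u = g j v -> i = j) ->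
  (#|I| <= betti K 0)%N.
Proof.
move=> hK wL gL gA gdisj.
apply: (betti0_ge_clusters (A := fun i => (g i @: finset.setT)%SET)) => //.
- move=> i j v /imsetP[u _ ->] /imsetP[u' _]; exact: gdisj.
- move=> i; exists (g i w); first by rewrite imset_f.
  by have [_ gK] := gL i; rewrite -imset_set1 gK.
Qed.

Lemma spherical_iso (V W : finType) (K : complex V) (L : complex W) k :
  complex_iso K L -> spherical L k -> spherical K k.
Proof.
move=> [h [[g hK gK] hL]] [[s0 s0L cs0] dimL evenL].
have hI := can_inj hK.
have kE : embeds L K h by [].
have sE (s : {set W}) : s = (h @: (h @^-1: s))%SET.
  by rewrite -(can2_imset_pre _ gK hK) -imset_comp (eq_imset _ gK) imset_id.
split.
- exists (h @^-1: s0)%SET; first by rewrite -hL -sE.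
  by rewrite -cs0 [in RHS](sE s0) card_imset.
- by move=> s sK; rewrite -(card_imset (mem s) hI) dimL// hL.
- move=> s sK cs; rewrite -(embeds_even _ kE); last first.
    move=> t _ _; apply/fintype.subsetP => x _.
    by apply/imsetP; exists (g x); rewrite ?gK.
  by apply: evenL; rewrite ?hL ?card_imset.
Qed.

(** A k-set in k+2 vertices misses two of them, either of which completes it to
    a facet. *)
Lemma hollow_simplex_spherical k : (0 < k)%N ->
  spherical (hollow_simplex k.+2) k.
Proof.
move=> k_gt0; split.
- exists [set~ ord0]%SET; last by rewrite cardsC1 card_ord.
  rewrite !inE -card_gt0 cardsC1 card_ord/=.
  by apply/eqP => /finset.setP/(_ ord0); rewrite !inE eqxx.
- move=> s; rewrite !inE => /andP[_]; apply: contra => /eqP cs.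
  by rewrite finset.eqEcard finset.subsetT cardsT card_ord cs ltnSn.
- move=> s; rewrite !inE => /andP[s0 sT] cs.
  suff -> : [set t in hollow_simplex k.+2 | (#|t| == k.+1) && (s \subset t)]%SET
    = [set t : {set _} | [&& #|t| == #|s|.+1, s \subset t
        & t \subset finset.setT]]%SET.
    rewrite card_intermediate ?finset.subsetT//.
    by rewrite cardsD (finset.setIidPr _) ?finset.subsetT// cardsT card_ord cs
      subSn// subSnn.
  apply/finset.setP => t; rewrite !inE cs finset.subsetT !andbT.
  case: (eqVneq #|t| k.+1); rewrite ?andbF//= => ct.
  case: (boolP (s \subset t)); rewrite ?andbF// => st.
  rewrite andbT -card_gt0 ct/=; apply/eqP => tT; move: ct.
  by rewrite tT cardsT card_ord => /eqP; rewrite eqn_leq ltnn.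
Qed.

Definition flag_complex (V : finType) (e : rel V) : complex V :=
  [set s : {set V} | (s != finset.set0) &&
    [forall u in s, forall v in s, (u != v) ==> e u v]]%SET.

(** A face has at most one vertex on each of the k+1 axes; a face with k vertices
    misses exactly one axis, on which there are two vertices to complete
    it. *)
Lemma cross_polytope_spherical k : (0 < k)%N ->
  spherical (flag_complex (cross_polytope k)) k.
Proof.
move=> k_gt0.
have flagP (s : {set 'I_k.+1 * bool}) :
    reflect (s != finset.set0 /\ {in s &, injective fst})
      (s \in flag_complex (cross_polytope k)).
  rewrite inE; apply: (iffP andP) => -[s0 h]; split => //.
    move=> u v us vs uv; apply/eqP/negPn/negP => nuv.
    by move: h => /forall_inP/(_ u us)/forall_inP/(_ v vs)/implyP/(_ nuv);
      rewrite /cross_polytope uv eqxx.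
  apply/forall_inP => u us; apply/forall_inP => v vs; apply/implyP => uv.
  by apply: contra uv => /eqP /h->.
split.
- exists [set (i, true) | i : 'I_k.+1]%SET.
    apply/flagP; split.
      by apply/finset.set0Pn; exists (ord0, true); rewrite imset_f.
    by move=> _ _ /imsetP[i _ ->] /imsetP[j _ ->]/= ->.
  by rewrite card_imset ?card_ord// => i j [].
- move=> s /flagP[_ sI]; apply/eqP => cs.
  have := max_card (mem (fst @: s)%SET).
  by rewrite card_in_imset// cs card_ord ltnn.
- move=> s /flagP[s0 sI] cs.
  have : #|~: (fst @: s)%SET|%SET == 1%N.
    by rewrite cardsCs finset.setCK card_in_imset// cs card_ord subSnn.
  move=> /cards1P[i0 si0].
  have i0P x : x \in s -> x.1 != i0.
    move=> xs; apply/eqP => xi0.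
    have : i0 \in (~: (fst @: s))%SET by rewrite si0 inE.
    by rewrite inE -xi0 imset_f.
  have nP i : i != i0 -> exists2 x, x \in s & x.1 = i.
    move=> ii0; have : i \notin (~: (fst @: s))%SET by rewrite si0 inE.
    by rewrite inE negbK => /imsetP[x xs ->]; exists x.
  suff -> : [set t in flag_complex (cross_polytope k) |
      (#|t| == k.+1) && (s \subset t)]%SET =
      [set ((i0, b) |: s)%SET | b : bool]%SET.
    rewrite card_imset ?card_bool// => b b' /finset.setP/(_ (i0, b)).
    rewrite !inE eqxx/= => /esym/orP[/eqP[]//|/i0P]; by rewrite eqxx.
  apply/finset.setP => t; rewrite inE; apply/idP/imsetP.
    move=> /andP[/flagP[_ tI] /andP[/eqP ct st]].
    have : #|t :\: s|%SET == 1%N.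
      by rewrite cardsD (finset.setIidPr st) ct cs subSnn.
    move=> /cards1P[x tsx].
    have : x \in (t :\: s)%SET by rewrite tsx inE.
    rewrite inE => /andP[xs xt].
    exists x.2 => //.
    have -> : (i0, x.2) = x.
      rewrite [RHS]surjective_pairing; congr pair; apply/esym/eqP/negPn/negP.
      move=> /nP[y ys yx]; move: xs; rewrite (tI x y)// ?ys//.
      exact: (fintype.subsetP st).
    by rewrite -tsx finset.setUC -{1}(finset.setID t s) (finset.setIidPr st).
  move=> [b _ ->]; apply/andP; split.
    apply/flagP; split; first by apply/finset.set0Pn; exists (i0, b); rewrite !inE eqxx.
    move=> u v; rewrite !inE => /orP[/eqP->|us] /orP[/eqP->|vs]//=.
    - by move=> e; move: (i0P _ vs); rewrite -e eqxx.
    - by move=> e; move: (i0P _ us); rewrite e eqxx.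
    - exact: sI.
  rewrite finset.subsetUr andbT cardsU1 cs.
  by have -> : (i0, b) \notin s by apply/negP => /i0P; rewrite eqxx.
Qed.

End spheres.

(** * Null sets of product measures *)

Section lower_integral.
Context d (T : measurableType d) (R : realType).
Variable mu : {measure set T -> \bar R}.
Local Open Scope ereal_scope.

(** The integral of a nonnegative function is the supremum of the integrals of
    the simple functions below it, measurable or not. This avoids proving that
    Betti numbers are measurable. *)
Lemma ge0_le_lower_integral (f g : T -> \bar R) :
  (forall x, 0 <= f x) -> (forall x, f x <= g x) ->
  \int[mu]_x f x <= \int[mu]_x g x.
Proof.
move=> f0 fg; have g0 x : 0 <= g x by exact: le_trans (f0 x) (fg x).
rewrite !ge0_integralTE//; apply: le_ereal_sup => _ [h /= hf <-].
by exists h => //= x; exact: le_trans (hf x) (fg x).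
Qed.

Import HBNNSimple.

(** For the same reason, a positive integral is witnessed by the support of a
    simple function, even for the integrand of gamma, which contains the
    indicator function of an isomorphism class of complexes. *)
Lemma integral_gt0_measurable_subset (f : T -> \bar R) :
  (forall x, 0 <= f x) -> 0 < \int[mu]_x f x ->
  exists E, [/\ measurable E, mu E != 0 & forall x, E x -> 0 < f x].
Proof.
move=> f0; rewrite ge0_integralTE// => /ereal_sup_gt[_ [h /= hf <-] h_gt0].
exists [set x | (0 < h x)%R]; split.
- rewrite [X in measurable X](_ : _ = h @^-1` `]0%R, +oo[%classic); last first.
    by apply/seteqP; split => x /=; rewrite in_itv/= andbT.
  by rewrite -[X in measurable X]setTI; exact: (measurable_funP h).
- apply: contraTN h_gt0 => /eqP E0; rewrite -leNgt.
  rewrite sintegralE fsume_le0// => _ [x _ <-].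
  have := @fun_ge0 _ _ h x; rewrite le_eqVlt => /predU1P[<-|hx].
    by rewrite mul0e.
  rewrite (_ : mu _ = 0) ?mule0//; apply: (subset_measure0 _ _ _ E0) => //.
  + rewrite [X in measurable X](_ : _ = h @^-1` `]0%R, +oo[%classic); last first.
      by apply/seteqP; split => z /=; rewrite in_itv/= andbT.
    by rewrite -[X in measurable X]setTI; exact: (measurable_funP h).
  + by move=> y /= ->.
- by move=> x /= hx; apply: lt_le_trans (hf x); rewrite lte_fin.
Qed.

End lower_integral.

Section null_sets.
Context (R : realType).
Local Open Scope ereal_scope.

Lemma ge0_integral_eq0P d (T : measurableType d)
    (mu : {measure set T -> \bar R}) (f : T -> \bar R) :
  measurable_fun setT f -> (forall x, 0 <= f x) ->
  \int[mu]_x f x = 0 <-> mu [set x | f x != 0] = 0.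
Proof.
move=> mf f0.
have mN : measurable [set x | f x != 0].
  by rewrite -[X in measurable X]setTI; exact: emeasurable_neq.
have -> : \int[mu]_x f x = \int[mu]_x `|f x|.
  by apply: eq_integral => x _; rewrite gee0_abs.
rewrite ae_eq_integral_abs//; split => [[N [mN' N0 NS]]|N0].
  apply: (subset_measure0 _ _ _ N0) => //.
  by move=> x /= fx; apply: NS => /= /(_ I) => fx0; rewrite fx0 eqxx in fx.
exists [set x | f x != 0]; split => // x /= h; apply/eqP => fx0; exact: h.
Qed.

Lemma product_measure_eq0P d1 d2 (T1 : measurableType d1)
    (T2 : measurableType d2) (m1 : {sigma_finite_measure set T1 -> \bar R})
    (m2 : {sigma_finite_measure set T2 -> \bar R}) (A : set (T1 * T2)) :
  measurable A ->
  (m1 \x m2) A = 0 <-> m1 [set x | m2 (xsection A x) != 0] = 0.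
Proof.
move=> mA; apply: ge0_integral_eq0P => //.
exact: measurable_fun_xsection.
Qed.

(** Only null sets matter here, so that maps are required to pull them back to
    null sets, without computing Jacobians. *)
Definition nonsingular d1 d2 (T1 : measurableType d1) (T2 : measurableType d2)
    (m1 : set T1 -> \bar R) (m2 : set T2 -> \bar R) (f : T1 -> T2) :=
  measurable_fun setT f /\
  forall N, measurable N -> m2 N = 0 -> m1 (f @^-1` N) = 0.


Lemma tuple_measureS d (T : measurableType d)
    (mu : {sigma_finite_measure set T -> \bar R}) n (N : set (n.+1.-tuple T)) :
  tuple_measure mu n.+1 N =
  (mu \x tuple_measure mu n) (@Defs.cons_tuple d T n @^-1` N).
Proof. by []. Qed.

Lemma measurable_coordinatewise d (T : measurableType d) n
    (f : 'I_n -> T -> T) (F : n.-tuple T -> n.-tuple T) :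
  (forall i, measurable_fun setT (f i)) ->
  (forall t i, tnth (F t) i = f i (tnth t i)) -> measurable_fun setT F.
Proof.
move=> mf Ff; apply/measurable_fun_tnthP => i.
rewrite [X in measurable_fun _ X](_ : _ = f i \o (fun t => tnth t i)).
  by apply: measurableT_comp; [exact: mf|exact: measurable_tnth].
by apply/funext => t; rewrite /= Ff.
Qed.

(** By Fubini, a set of (n+1)-tuples is null when almost all of its sections are;
    the sections of the preimage of N at x are preimages of sections of N at
    f ord0 x. *)
Lemma nonsingular_tuple d (T : measurableType d)
    (mu : {sigma_finite_measure set T -> \bar R}) n (f : 'I_n -> T -> T)
    (F : n.-tuple T -> n.-tuple T) :
  (forall i, nonsingular mu mu (f i)) ->
  (forall t i, tnth (F t) i = f i (tnth t i)) ->
  nonsingular (tuple_measure mu n) (tuple_measure mu n) F.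
Proof.
elim: n f F => [|n IH] f F nf Ff; split.
- by apply/measurable_fun_tnthP => -[].
- move=> N mN N0; rewrite (_ : F @^-1` N = N)//.
  by apply/seteqP; split => t /=; rewrite (tuple0 (F t)) (tuple0 t).
- by apply: measurable_coordinatewise Ff => i; exact: (nf i).1.
- move=> N mN; rewrite !tuple_measureS.
  have mF : measurable_fun setT F.
    by apply: measurable_coordinatewise Ff => i; exact: (nf i).1.
  have mcN (M : set (n.+1.-tuple T)) : measurable M ->
      measurable (@Defs.cons_tuple d T n @^-1` M).
    by move=> mM; rewrite -[X in measurable X]setTI; exact: measurable_cons_tuple.
  have mFN : measurable (F @^-1` N).
    by rewrite -[X in measurable X]setTI; exact: mF.
  move/(product_measure_eq0P _ _ (mcN _ mN)).1 => N0.
  apply/product_measure_eq0P; first exact: mcN.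
  pose F' (t : n.-tuple T) : n.-tuple T :=
    [tuple f (lift ord0 i) (tnth t i) | i < n].
  have nF' : nonsingular (tuple_measure mu n) (tuple_measure mu n) F'.
    apply: (IH (fun i => f (lift ord0 i))) => // t i.
    by rewrite tnth_mktuple.
  have FE x (t : n.-tuple T) :
      F (Defs.cons_tuple (x, t)) = Defs.cons_tuple (f ord0 x, F' t).
    apply: eq_from_tnth => i; rewrite Ff.
    case: (unliftP ord0 i) => [j|] ->; last by rewrite !tnth0.
    by rewrite !tnthS tnth_mktuple.
  set B := [set x | _ != 0] in N0.
  have mB : measurable B.
    rewrite -[X in measurable X]setTI; apply: emeasurable_neq => //.
    by apply: measurable_fun_xsection; exact: mcN.
  have mx (x : T) : measurable (xsection (@Defs.cons_tuple d T n @^-1` N) x).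
    by apply: measurable_xsection; exact: mcN.
  have sE x : xsection (@Defs.cons_tuple d T n @^-1` (F @^-1` N)) x =
      F' @^-1` xsection (@Defs.cons_tuple d T n @^-1` N) (f ord0 x).
    by apply/seteqP; split => t /=; rewrite /xsection/= !inE/= FE.
  apply: (subset_measure0 _ _ _ ((nf ord0).2 _ mB N0)).
  + rewrite -[X in measurable X]setTI; apply: emeasurable_neq => //.
    by apply: measurable_fun_xsection; exact: mcN.
  + by rewrite -[X in measurable X]setTI; exact: (nf ord0).1.
  + move=> x /=; apply: contraNN => /eqP s0.
    by rewrite sE; apply/eqP; apply: nF'.2.
Qed.

(** Lebesgue measure is c times its image, by comparison on intervals. *)
Lemma lebesgue_nonsingular_affine (c z : R) : (0 < c)%R ->
  nonsingular (@lebesgue_measure R) (@lebesgue_measure R)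
    (fun t : measurableTypeR R => (c * t + z)%R : measurableTypeR R).
Proof.
move=> c0.
have mf : measurable_fun [set: measurableTypeR R]
    (fun t : measurableTypeR R => (c * t + z)%R : measurableTypeR R).
  by apply: measurable_funD => //; exact: measurable_funM.
split=> // N mN N0.
have mg : measurable_fun [set: measurableTypeR R]
    (fun t : measurableTypeR R => ((t - z) / c)%R : measurableTypeR R).
  by apply: measurable_funM => //; exact: measurable_funB.
have fK : cancel (fun t : measurableTypeR R => (c * t + z)%R : measurableTypeR R)
    (fun t : measurableTypeR R => ((t - z) / c)%R : measurableTypeR R).
  by move=> t; rewrite addrK mulrC mulKf// gt_eqF.
pose nu : {measure set (measurableTypeR R) -> \bar R} :=
  mscale (NngNum (ltW c0)) (iso_image (@lebesgue_measure R) mf mg fK).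
have /= : lebesgue_measure N = nu N.
  apply: lebesgue_measure_unique => // _ [[a b]] _ <-.
  rewrite /nu/= /mscale/= /iso_image /pushforward.
  rewrite (_ : _ @^-1` _ = `]((a - z) / c)%R, ((b - z) / c)%R]%classic); last first.
    apply/seteqP; split => t /=; rewrite !in_itv/=.
      by rewrite ltr_pdivrMr// ler_pdivlMr// ltrBlDr lerBrDr mulrC.
    by rewrite ltr_pdivrMr// ler_pdivlMr// ltrBlDr lerBrDr mulrC.
  rewrite !lebesgue_measure_itv/= !lte_fin ltr_pM2r ?invr_gt0// ltrD2r.
  case: ifPn => _; last by rewrite mule0.
  rewrite -!EFinD -EFinM; congr EFin.
  by rewrite -mulrBl mulrC mulfVK ?gt_eqF//; lra.
rewrite N0 /mscale /iso_image /pushforward /= => /esym/eqP.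
rewrite mule_eq0 => /orP[|/eqP//].
by rewrite eqe gt_eqF.
Qed.

Lemma measurable_affine_mx k d (c : R) (z : 'M[R]_(k, d)) :
  measurable_fun setT (fun x : 'M[R]_(k, d) => (c *: x + z)%R).
Proof.
apply: measurable_mxP => i j; under eq_fun do rewrite !mxE.
by apply: measurable_funD => //; apply: measurable_funM => //;
  exact: measurable_coord.
Qed.

Lemma rv_nonsingular_affine d (c : R) (z : 'rV[R]_d) : (0 < c)%R ->
  nonsingular (rv_lebesgue R d) (rv_lebesgue R d) (fun x => (c *: x + z)%R).
Proof.
move=> c0; split; first exact: measurable_affine_mx.
move=> N mN; pose F (t : d.-tuple (measurableTypeR R)) :
    d.-tuple (measurableTypeR R) := [tuple (c * tnth t i + z 0 i)%R | i < d].
have nF : nonsingular (tuple_measure (@lebesgue_measure R) d)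
    (tuple_measure (@lebesgue_measure R) d) F.
  apply: (@nonsingular_tuple _ _ (@lebesgue_measure R) d
    (fun i (t : measurableTypeR R) => (c * t + z 0 i)%R : measurableTypeR R) F).
    by move=> i; exact: lebesgue_nonsingular_affine.
  by move=> t i; rewrite tnth_mktuple.
rewrite /rv_lebesgue/= /iso_image /pushforward => N0.
rewrite (_ : _ @^-1` _ = F @^-1` (@row_of_tuple R d @^-1` N)).
  apply: nF.2 => //.
  by rewrite -[X in measurable X]setTI; exact: measurable_row_of_tuple.
apply/seteqP; suff e t : (c *: row_of_tuple t + z)%R = row_of_tuple (F t).
  by split => t /=; rewrite e.
by apply/rowP => i; rewrite !mxE tnth_mktuple.
Qed.

Lemma mx_lebesgueE k d (N : set 'M[R]_(k, d)) : mx_lebesgue R k d N =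
  tuple_measure (rv_lebesgue R d) k (@mx_of_tuple R k d @^-1` N).
Proof. by []. Qed.

Lemma mx_nonsingular_affine k d (c : R) (z : 'M[R]_(k, d)) : (0 < c)%R ->
  nonsingular (mx_lebesgue R k d) (mx_lebesgue R k d) (fun x => (c *: x + z)%R).
Proof.
move=> c0; split; first exact: measurable_affine_mx.
move=> N mN; pose F (t : k.-tuple 'rV[R]_d) : k.-tuple 'rV[R]_d :=
  [tuple (c *: tnth t i + row i z)%R | i < k].
have nF : nonsingular (tuple_measure (rv_lebesgue R d) k)
    (tuple_measure (rv_lebesgue R d) k) F.
  apply: (@nonsingular_tuple _ _ (rv_lebesgue R d) k
    (fun i t => (c *: t + row i z)%R) F).
    by move=> i; exact: rv_nonsingular_affine.
  by move=> t i; rewrite tnth_mktuple.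
rewrite !mx_lebesgueE => N0.
rewrite (_ : _ @^-1` _ = F @^-1` (@mx_of_tuple R k d @^-1` N)).
  apply: nF.2 => //.
  by rewrite -[X in measurable X]setTI; exact: measurable_mx_of_tuple.
apply/seteqP; suff e t : (c *: mx_of_tuple t + z)%R = mx_of_tuple (F t).
  by split => t /=; rewrite e.
by apply/matrixP => i j; rewrite !mxE tnth_mktuple !mxE.
Qed.

(** Converse of nonsingularity, through the inverse affine map. *)
Lemma mx_affine_eq0 k d (c : R) (z : 'M[R]_(k, d)) (N : set 'M[R]_(k, d)) :
  (0 < c)%R -> measurable N ->
  mx_lebesgue R k d ((fun x => (c *: x + z)%R) @^-1` N) = 0 ->
  mx_lebesgue R k d N = 0.
Proof.
move=> c0 mN N0.
have cV0 : (0 < c^-1)%R by rewrite invr_gt0.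
have mN' : measurable ((fun x : 'M[R]_(k, d) => (c *: x + z)%R) @^-1` N).
  by rewrite -[X in measurable X]setTI; exact: measurable_affine_mx.
rewrite -[RHS]((mx_nonsingular_affine (- c^-1 *: z)%R cV0).2 _ mN' N0).
congr (mx_lebesgue _ _ _ _); apply/seteqP.
suff e x : (c *: (c^-1 *: x + - c^-1 *: z) + z)%R = x by split => x /=; rewrite e.
rewrite scalerDr !scalerA mulrN mulfV ?gt_eqF// scale1r scaleN1r addrNK//.
Qed.

Lemma tuple_measureT_neq0 d (T : measurableType d)
    (mu : {sigma_finite_measure set T -> \bar R}) n :
  mu setT != 0 -> tuple_measure mu n setT != 0.
Proof.
move=> mu0; elim: n => [|n IH]; first by rewrite /= diracT onee_neq0.
rewrite tuple_measureS preimage_setT; apply/eqP.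
move/(product_measure_eq0P _ _ (@measurableT _ _)).1/eqP.
rewrite (_ : [set x | _] = setT); first exact/negP.
by apply/seteqP; split => // x _ /=; rewrite xsectionE preimage_setT.
Qed.

Lemma rv_lebesgueT_neq0 d : rv_lebesgue R d setT != 0.
Proof.
rewrite /rv_lebesgue/= /iso_image /pushforward preimage_setT.
apply: tuple_measureT_neq0; apply/eqP => T0.
have : lebesgue_measure (`[0%R, 1%R]%classic : set (measurableTypeR R)) = 0%E.
  by apply: (subset_measure0 _ _ _ T0).
rewrite lebesgue_measure_itv/= lte_fin ltr01 -EFinD subr0 => /eqP.
by rewrite eqe oner_eq0.
Qed.

(** The inverse of the parametrization of tuples by their first point and by the
    integration variable of gamma: the rows of index i > 0 relative to the first
    one, in the unit b. *)
Definition relative_rows k d (b : R) (x : 'M[R]_(k.+1, d)) : 'M[R]_(k, d) :=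
  \matrix_(i, j) (b^-1 * (x (lift ord0 i) j - x ord0 j))%R.

Lemma measurable_relative_rows k d b :
  measurable_fun setT (@relative_rows k d b).
Proof.
apply: measurable_mxP => i j; under eq_fun do rewrite !mxE.
by apply: measurable_funM => //; apply: measurable_funB;
  exact: measurable_coord.
Qed.

(** The sections at a fixed first point are affine preimages of E, none of which
    is null. *)
Lemma mx_lebesgue_relative_rows k d (b : R) (E : set 'M[R]_(k, d)) :
  (0 < b)%R -> measurable E -> mx_lebesgue R k d E != 0 ->
  mx_lebesgue R k.+1 d (@relative_rows k d b @^-1` E) != 0.
Proof.
move=> b0 mE; apply: contraNN => /eqP.
have mX : measurable (@relative_rows k d b @^-1` E).
  by rewrite -[X in measurable X]setTI; exact: measurable_relative_rows.
have mX' : measurable (@mx_of_tuple R k.+1 d @^-1` (@relative_rows k d b @^-1` E)).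
  by rewrite -[X in measurable X]setTI; exact: measurable_mx_of_tuple.
have mX'' : measurable (@Defs.cons_tuple _ _ k @^-1`
    (@mx_of_tuple R k.+1 d @^-1` (@relative_rows k d b @^-1` E))).
  by rewrite -[X in measurable X]setTI; exact: measurable_cons_tuple.
rewrite mx_lebesgueE tuple_measureS.
move/(product_measure_eq0P _ _ mX'').1; set B := [set x | _ != 0] => B0.
have /eqP : rv_lebesgue R d setT != 0 := rv_lebesgueT_neq0 d.
apply: contra_notP => E0.
rewrite -B0; congr (rv_lebesgue _ _ _); apply/seteqP; split => // z _.
rewrite /B/=; apply/eqP => z0; apply: E0; apply/eqP.
pose zz : 'M[R]_(k, d) := (\matrix_(i, j) (- b^-1 * z 0 j))%R.
apply: (@mx_affine_eq0 _ _ b^-1%R zz) => //; first by rewrite invr_gt0.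
rewrite mx_lebesgueE -[RHS]z0.
congr (tuple_measure _ _ _); apply/seteqP.
suff e t : (b^-1 *: mx_of_tuple t + zz)%R =
    relative_rows b (mx_of_tuple (Defs.cons_tuple (z, t))).
  by split => t /=; rewrite /xsection/= ?inE/= e.
apply/matrixP => i j; rewrite !mxE tnth0 tnthS.
by rewrite mulrBr mulNr.
Qed.

End null_sets.

(** * Euclidean distance *)

Section euclidean_distance.
Context (R : realType) (d : nat).
Implicit Types x y z p q : 'rV[R]_d.

Lemma sum_sqr_ge0 (a : 'I_d -> R) : 0 <= \sum_i a i ^+ 2.
Proof. by apply: sumr_ge0 => i _; exact: sqr_ge0. Qed.

(** Expand the sum of the squares (B a_i - C b_i)^2. *)
Lemma cauchy_schwarz (a b : 'I_d -> R) :
  (\sum_i a i * b i) ^+ 2 <= (\sum_i a i ^+ 2) * (\sum_i b i ^+ 2).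
Proof.
set A := \sum_i a i ^+ 2; set B := \sum_i b i ^+ 2; set C := \sum_i a i * b i.
have B0 : 0 <= B by exact: sum_sqr_ge0.
have key : 0 <= B * (A * B - C ^+ 2).
  suff -> : B * (A * B - C ^+ 2) = \sum_i (B * a i - C * b i) ^+ 2.
    exact: sum_sqr_ge0.
  have -> : \sum_i (B * a i - C * b i) ^+ 2 =
      \sum_i (B ^+ 2 * a i ^+ 2 + (- (2 * B * C)) * (a i * b i)
              + C ^+ 2 * b i ^+ 2).
    by apply: eq_bigr => i _; ring.
  by rewrite !big_split/= -!mulr_sumr -/A -/B -/C; ring.
move: B0; rewrite le_eqVlt => /predU1P[B0|B0]; last first.
  by move: key; rewrite pmulr_rge0// subr_ge0.
have b0 i : b i = 0.
  apply/eqP; rewrite -sqrf_eq0; apply/eqP.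
  have /eqP := esym B0; rewrite psumr_eq0; last by move=> *; exact: sqr_ge0.
  by move=> /allP/(_ i (mem_index_enum _))/eqP.
rewrite -B0 mulr0 [C](_ : _ = 0) ?expr0n//.
by rewrite /C big1// => i _; rewrite b0 mulr0.
Qed.

Lemma edist_ge0 x y : 0 <= edist x y.
Proof. exact: sqrtr_ge0. Qed.

Lemma edistxx x : edist x x = 0.
Proof. by rewrite /edist big1 ?sqrtr0// => i _; rewrite subrr expr0n. Qed.

Lemma edistC x y : edist x y = edist y x.
Proof.
by congr Num.sqrt; apply: eq_bigr => i _; rewrite -sqrrN opprB.
Qed.

Lemma edist_triangle y x z : edist x z <= edist x y + edist y z.
Proof.
rewrite -ler_sqr ?nnegrE ?addr_ge0 ?edist_ge0//.
rewrite sqrrD !sqr_sqrtr ?sum_sqr_ge0//.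
set a := fun i => x 0 i - y 0 i; set b := fun i => y 0 i - z 0 i.
have -> : \sum_i (x 0 i - z 0 i) ^+ 2 =
    \sum_i a i ^+ 2 + (\sum_i a i * b i) *+ 2 + \sum_i b i ^+ 2.
  rewrite -sumrMnl -!big_split/=; apply: eq_bigr => i _.
  by rewrite /a /b; ring.
rewrite lerD2r lerD2l ler_pMn2r//.
rewrite /edist -sqrtrM ?sum_sqr_ge0//.
apply: le_trans (ler_norm _) _; rewrite -sqrtr_sqr.
by apply: ler_wsqrtr; exact: cauchy_schwarz.
Qed.

Lemma coord_le_edist x y i : `|x 0 i - y 0 i| <= edist x y.
Proof.
rewrite -sqrtr_sqr; apply: ler_wsqrtr.
by rewrite (bigD1 i)//= lerDl sumr_ge0// => j _; exact: sqr_ge0.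
Qed.

Lemma edist_eq0 x y : edist x y = 0 -> x = y.
Proof.
move=> xy0; apply/rowP => i; apply/eqP; rewrite -subr_eq0 -normr_le0 -xy0.
exact: coord_le_edist.
Qed.

Lemma edist_affine (c : R) z x y : 0 <= c ->
  edist (c *: x + z) (c *: y + z) = c * edist x y.
Proof.
move=> c0; rewrite -[c in RHS]ger0_norm// -sqrtr_sqr -sqrtrM ?sqr_ge0//.
congr Num.sqrt; rewrite mulr_sumr; apply: eq_bigr => i _.
by rewrite !mxE; ring.
Qed.

(** The margin d+1 instead of the square root of d also covers d = 0. *)
Lemma edist_lt (e : R) x y : 0 < e ->
  (forall i, `|x 0 i - y 0 i| <= e / d.+1%:R) -> edist x y < e.
Proof.
move=> e0 xye; rewrite -ltr_sqr ?nnegrE ?edist_ge0 ?(ltW e0)//.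
rewrite sqr_sqrtr ?sum_sqr_ge0//; set M := e / d.+1%:R.
have M0 : 0 < M by rewrite divr_gt0.
have -> : e = d.+1%:R * M by rewrite mulrC divfK// pnatr_eq0.
apply: (@le_lt_trans _ _ (\sum_(i < d) M ^+ 2)).
  apply: ler_sum => i _; rewrite -[_ ^+ 2]ger0_norm ?sqr_ge0//.
  by rewrite normrX lerXn2r ?nnegrE ?(ltW M0)// xye.
rewrite sumr_const card_ord [ltRHS]exprMn -[ltLHS]mulr_natl ltr_pM2r ?exprn_gt0//.
by rewrite -natrX ltr_nat -{1}(expn1 d.+1) leq_pexp2l.
Qed.

(** The midpoint is in both balls. *)
Lemma eball_meetP x y (r : R) :
  (eball x (r / 2) `&` eball y (r / 2) !=set0) <-> edist x y <= r.
Proof.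
split => [[p [xp yp]]|xyr].
  apply: (le_trans (edist_triangle p _ _)).
  by rewrite (splitr r) lerD// edistC.
exists (2^-1 *: x + 2^-1 *: y); rewrite /eball/=.
have e z : z = 2^-1 *: z + 2^-1 *: z.
  by rewrite -scalerDl (_ : 2^-1 + 2^-1 = 1 :> R) ?scale1r//; lra.
split.
  rewrite edistC {2}(e x) (addrC _ (_ *: y)) edist_affine//.
  by rewrite edistC mulrC ler_pM2r.
by rewrite edistC {2}(e y) edist_affine// mulrC ler_pM2r.
Qed.

End euclidean_distance.

Lemma measurable_edist (R : realType) d dT (T : measurableType dT)
    (f : T -> 'rV[R]_d) (q : 'rV[R]_d) :
  measurable_fun setT f -> measurable_fun setT (fun x => edist (f x) q).
Proof.
move=> mf.
have ms : measurable_fun setT (@Num.sqrt R).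
  by apply: continuous_measurable_fun; exact: sqrt_continuous.
apply: (measurableT_comp ms); apply: measurable_sum => i.
apply: measurable_funX; apply: measurable_funB => //.
by apply: (measurableT_comp (measurable_coord 0 i)).
Qed.

Lemma measurable_row (R : realType) k d (i : 'I_k) :
  measurable_fun setT (@row R k d i).
Proof.
apply: measurable_mxP => l j; under eq_fun do rewrite mxE.
exact: measurable_coord.
Qed.

Lemma measurable_ltr (R : realType) dT (T : measurableType dT) (f g : T -> R) :
  measurable_fun setT f -> measurable_fun setT g ->
  measurable [set x | f x < g x].
Proof.
move=> mf mg.
rewrite (_ : [set x | _] = (fun x => f x < g x) @^-1` [set true]); last first.
  by apply/seteqP; split => x /=.
by rewrite -[X in measurable X]setTI; exact: measurable_fun_ltr.
Qed.

Lemma measurable_ler (R : realType) dT (T : measurableType dT) (f g : T -> R) :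
  measurable_fun setT f -> measurable_fun setT g ->
  measurable [set x | f x <= g x].
Proof.
move=> mf mg.
rewrite (_ : [set x | _] = (fun x => f x <= g x) @^-1` [set true]); last first.
  by apply/seteqP; split => x /=.
by rewrite -[X in measurable X]setTI; exact: measurable_fun_ler.
Qed.

Lemma row_scale (R : realType) k d (c : R) (x : 'M[R]_(k, d)) i :
  row i (c *: x) = c *: row i x.
Proof. by apply/rowP => j; rewrite !mxE. Qed.

Section rational_points.
Context (R : realType).

Lemma rat_approx k d (x : 'M[R]_(k, d)) (e : R) : 0 < e ->
  exists q : 'M[rat]_(k, d),
    forall i, edist (row i x) (row i (map_mx ratr q)) < e.
Proof.
move=> e0; pose M := e / d.+1%:R.
have M0 : 0 < M by rewrite divr_gt0.
have /choice[q qP] : forall ij : 'I_k * 'I_d, exists q : rat,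
    `|x ij.1 ij.2 - ratr q| <= M.
  move=> [i j]/=; have [|q] := @rat_in_itvoo R (x i j - M) (x i j + M).
    by rewrite ltrD2l gtrN.
  rewrite in_itv/= => /andP[q1 q2]; exists q.
  by rewrite ler_norml; apply/andP; split; lra.
exists (\matrix_(i, j) q (i, j)) => i; apply: edist_lt => // j.
by rewrite !mxE; exact: (qP (i, j)).
Qed.

Lemma invn_lt (e : R) : 0 < e -> exists n, n.+1%:R^-1 < e.
Proof.
move=> e0; have eV : 0 <= e^-1 by rewrite invr_ge0 ltW.
exists (Num.bound e^-1); rewrite invf_plt ?posrE//.
by apply: lt_trans (archi_boundP eV) _; rewrite ltr_nat.
Qed.

Lemma finite_min_gt0 (I : finType) (S : {set I}) (f : I -> R) :
  (forall i, i \in S -> 0 < f i) ->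
  exists2 e : R, 0 < e & forall i, i \in S -> e <= f i.
Proof.
move=> f0; exists (\big[Order.min/1]_(i in S) f i).
  exact: lt_bigmin.
by move=> i iS; exact: bigmin_le_cond.
Qed.

End rational_points.

(** * Patterns of intersecting balls *)

Section patterns.
Context (R : realType) (k d : nat).
Implicit Types (x : 'M[R]_(k, d)) (S : {set 'I_k}).

Definition balls_meet x S (s : R) :=
  exists q : 'rV[R]_d, forall i, i \in S -> edist (row i x) q <= s.

Definition open_balls_meet x S (s : R) :=
  exists q : 'rV[R]_d, forall i, i \in S -> edist (row i x) q < s.

(** The tuples such that the smallest ball that contains the rows in S has radius
    exactly s. *)
Definition critical S (s : R) : set 'M[R]_(k, d) :=
  [set x | (forall e : R, 0 < e -> open_balls_meet x S (s + e)) /\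
           ~ open_balls_meet x S s].

Lemma open_balls_meet_rat x S s : open_balls_meet x S s <->
  exists q : 'rV[rat]_d, forall i, i \in S -> edist (row i x) (map_mx ratr q) < s.
Proof.
split => [[q qs]|[q qs]]; last by exists (map_mx ratr q).
have [|e e0 es] := @finite_min_gt0 R 'I_k S (fun i => s - edist (row i x) q).
  by move=> i /qs; rewrite subr_gt0.
have [q' q'P] := rat_approx q e0; exists q' => i iS.
apply: (le_lt_trans (edist_triangle q _ _)).
have ise := es _ iS.
have := q'P ord0; rewrite !row_id => q'e.
lra.
Qed.

Lemma open_balls_meetW x S s s' : s <= s' ->
  open_balls_meet x S s -> open_balls_meet x S s'.
Proof. by move=> ss' [q qs]; exists q => i /qs /lt_le_trans; apply. Qed.

Lemma open_balls_meet_scale x S s (c : R) : 0 < c ->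
  open_balls_meet (c *: x) S (c * s) <-> open_balls_meet x S s.
Proof.
move=> c0; split => -[q qs].
  exists (c^-1 *: q) => i /qs qsi; rewrite -(ltr_pM2l c0).
  have e : forall v w : 'rV[R]_d, c * edist v w = edist (c *: v) (c *: w).
    by move=> v w; have := edist_affine 0 v w (ltW c0); rewrite !addr0 => ->.
  by rewrite e scalerA mulfV ?gt_eqF// scale1r -row_scale.
exists (c *: q) => i /qs; rewrite -(ltr_pM2l c0).
by have := edist_affine 0 (row i x) q (ltW c0); rewrite !addr0 row_scale => ->.
Qed.

(** If the enclosing radius is less than s, a common point is at a distance less
    than s from all the rows with some margin; if it is more than s, there is no
    common point at radius s + e. *)
Lemma balls_meet_robust x S s : ~ critical S s x ->
  exists2 e : R, 0 < e & forall x' (s' : R),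
    (forall i, edist (row i x) (row i x') <= e) -> `|s' - s| <= e ->
    (balls_meet x' S s' <-> balls_meet x S s).
Proof.
move=> /not_andP[/existsNP[e /not_implyP[e0 nm]]|/contrapT[q qs]].
  have nmS (s' : R) x' : balls_meet x' S s' ->
      (forall i, edist (row i x) (row i x') <= e / 3) -> s' <= s + e / 3 -> False.
    move=> [q qs] xx' ss'; apply: nm; exists q => i iS.
    apply: (le_lt_trans (edist_triangle (row i x') _ _)).
    have := qs _ iS; have := xx' i; lra.
  exists (e / 3); first by rewrite divr_gt0.
  move=> x' s' xx'; rewrite ler_norml => /andP[_ ss']; split => [m|m].
    by exfalso; apply: (nmS _ _ m xx'); lra.
  by exfalso; apply: (nmS _ _ m) => [i|]; rewrite ?edistxx; lra.
have [|e e0 es] := @finite_min_gt0 R 'I_k S (fun i => s - edist (row i x) q).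
  by move=> i /qs; rewrite subr_gt0.
exists (e / 2); first by rewrite divr_gt0.
move=> x' s' xx'; rewrite ler_norml => /andP[ss' _]; split => _.
  by exists q => i /qs/ltW.
exists q => i iS; apply: (le_trans (edist_triangle (row i x) _ _)).
have := es _ iS; have := xx' i; rewrite edistC; lra.
Qed.

(** Open balls meet in a rational point, whence a countable union. *)
Lemma measurable_open_balls_meet S :
  measurable [set tx : measurableTypeR R * 'M[R]_(k, d) |
    open_balls_meet tx.2 S tx.1].
Proof.
have -> : [set tx : measurableTypeR R * 'M[R]_(k, d) |
    open_balls_meet tx.2 S tx.1] =
  \bigcup_(q in [set: 'rV[rat]_d]) \bigcap_(i in [set i | i \in S])
    [set tx : measurableTypeR R * 'M[R]_(k, d) |
      edist (row i tx.2) (map_mx ratr q) < tx.1].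
  apply/seteqP; split => [tx /open_balls_meet_rat[q qs]|tx [q _ qs]].
    by exists q => // i /= iS; exact: qs.
  by apply/open_balls_meet_rat; exists q => i iS; exact: qs.
apply: countable_bigcupT_measurable => [|q]; first exact: countableP.
apply: fin_bigcap_measurable => // i _.
apply: (@measurable_ltr R _ (measurableTypeR R * 'M[R]_(k, d))%type
  (fun tx => edist (row i tx.2) (map_mx ratr q)) fst) => //.
apply: (@measurable_edist R d _ _ (fun tx => row i tx.2)).
by apply: (measurableT_comp (@measurable_row R k d i)).
Qed.

Lemma measurable_critical_pairs S :
  measurable [set tx : measurableTypeR R * 'M[R]_(k, d) | critical S tx.1 tx.2].
Proof.
have -> : [set tx : measurableTypeR R * 'M[R]_(k, d) |
    critical S tx.1 tx.2] = (\bigcap_n [set tx : measurableTypeR R * 'M[R]_(k, d) |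
     open_balls_meet tx.2 S (tx.1 + n.+1%:R^-1)]) `\`
   [set tx : measurableTypeR R * 'M[R]_(k, d) | open_balls_meet tx.2 S tx.1].
  apply/seteqP; split => -[t x]/= [h nm]; split => //.
    by move=> n _ /=; apply: h; rewrite invr_gt0.
  move=> e /invn_lt[n ne].
  by have := h n I; apply: open_balls_meetW; rewrite /= lerD2l ltW.
apply: measurableD; last exact: measurable_open_balls_meet.
apply: bigcapT_measurable => n.
pose F (tx : measurableTypeR R * 'M[R]_(k, d)) :
  measurableTypeR R * 'M[R]_(k, d) := (tx.1 + n.+1%:R^-1, tx.2).
have mF : measurable_fun setT F.
  by apply: measurable_fun_pair => //; exact: measurable_funD.
have := mF measurableT _ (measurable_open_balls_meet S).
by rewrite setTI.
Qed.

Lemma measurable_critical S (c : R) : measurable (critical S c).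
Proof.
have := measurable_xsection (c : measurableTypeR R) (measurable_critical_pairs S).
by congr measurable; apply/seteqP; split => x; rewrite /xsection/= inE.
Qed.

(** A tuple is critical for one radius at most, so the set of pairs (t, x) with x
    critical for the radius t is null by Fubini, and almost every level set is
    null; scaling by t / c carries the level c to the level t. *)
Lemma critical_null S (c : R) : 0 < c -> mx_lebesgue R k d (critical S c) = 0%E.
Proof.
move=> c0.
pose D := [set tx : measurableTypeR R * 'M[R]_(k, d) | critical S tx.1 tx.2].
have mD : measurable D := measurable_critical_pairs S.
have ae0 : lebesgue_measure
    ([set t | mx_lebesgue R k d (xsection D t) != 0%E] : set (measurableTypeR R))
    = 0%E.
  apply/ge0_integral_eq0P => //; first exact: measurable_fun_xsection.
  have := @indic_fubini_tonelli _ _ _ _ R (@lebesgue_measure R)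
    (mx_lebesgue R k d) _ mD.
  rewrite indic_fubini_tonelli_FE// indic_fubini_tonelli_GE// => ->.
  apply: integral0_eq => x _ /=.
  have [[t0 Dt0]|nD] := pselect (exists t, D (t, x)); last first.
    rewrite (_ : ysection D x = set0) ?measure0//.
    apply/seteqP; split => // t; rewrite /ysection/= inE => Dt.
    by apply: nD; exists t.
  apply: (subset_measure0 _ _ _ (lebesgue_measure_set1 t0)) => //.
    exact: measurable_ysection.
  move=> t; rewrite /ysection/= inE /D/= => -[h nm].
  case: Dt0 => /= h0 nm0.
  have [tt0|tt0|//] := ltgtP t t0.
  - by exfalso; apply: nm0; have := h (t0 - t); rewrite subrKC subr_gt0; apply.
  - by exfalso; apply: nm; have := h0 (t - t0); rewrite subrKC subr_gt0; apply.
have [t t0 Lt0] : exists2 t, 0 < t & mx_lebesgue R k d (critical S t) = 0%E.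
  apply: contrapT => nt.
  have : lebesgue_measure (`]0, 1]%classic : set (measurableTypeR R)) = 0%E.
    apply: (subset_measure0 _ _ _ ae0) => //.
      rewrite -[X in measurable X]setTI; apply: emeasurable_neq => //.
      exact: measurable_fun_xsection.
    move=> t /=; rewrite in_itv/= => /andP[t0 _]; apply/eqP => Dt.
    apply: nt; exists t => //; rewrite -[RHS]Dt; congr (mx_lebesgue _ _ _ _).
    by apply/seteqP; split => x; rewrite /xsection/= inE.
  rewrite lebesgue_measure_itv/= lte_fin ltr01 -EFinD subr0 => /eqP.
  by rewrite eqe oner_eq0.
have mt := measurable_critical S t.
have tc : 0 < t / c by rewrite divr_gt0.
rewrite -[RHS]((mx_nonsingular_affine 0 tc).2 _ mt Lt0).
congr (mx_lebesgue _ _ _ _); apply/seteqP.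
suff e x : critical S c x <-> critical S t (t / c *: x + 0).
  by split => x /e.
have tE : t = t / c * c by rewrite divfK// gt_eqF.
rewrite addr0; split => -[h nm]; split.
- move=> e e0; rewrite (_ : t + e = t / c * (c + c / t * e)); last first.
    by field; rewrite !gt_eqF.
  by apply/open_balls_meet_scale => //; apply: h; rewrite mulr_gt0 ?divr_gt0.
- by rewrite {2}tE => /(open_balls_meet_scale _ _ _ tc).
- move=> e e0; apply/(open_balls_meet_scale _ _ _ tc).
  by rewrite mulrDr -tE; apply: h; rewrite mulr_gt0.
- by rewrite {2}tE in nm; move=> /(open_balls_meet_scale _ _ _ tc).
Qed.

End patterns.

(** * Events expressed by numbers of points *)

Section counting_events.
Context (R : realType) (d : nat).
Implicit Types (C : config R d) (B : set 'rV[R]_d) (z : 'rV[R]_d).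

Lemma measurable_config_count B : measurable B ->
  measurable_fun setT (fun C : config R d => config_count C B).
Proof.
move=> mB _ Y mY; rewrite setTI; apply: sub_sigma_algebra.
by exists B => //; exists Y => //; rewrite setTI.
Qed.

Lemma config_count_eq0 C B : config_count C B = 0%E <-> C `&` B = set0.
Proof.
rewrite /config_count /counting; split => [|->].
  case: ifPn => // /asboolP fCB /eqP; rewrite eqe pnatr_eq0 cardfs_eq0.
  by move=> /eqP CB0; rewrite -(fset_setK fCB) CB0 set_fset0.
by rewrite asboolT ?fset_set0 ?cardfs0//; exact: finite_set0.
Qed.

Lemma measurable_config_void B : measurable B ->
  measurable [set C : config R d | C `&` B = set0].
Proof.
move=> mB.
rewrite [X in measurable X](_ : _ = (fun C : config R d => config_count C B) @^-1` [set 0%E]).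
  rewrite -[X in measurable X]setTI; exact: measurable_config_count.
by apply/seteqP; split => C /config_count_eq0.
Qed.

Lemma measurable_config_count_le B n : measurable B ->
  measurable [set C : config R d | (config_count C B <= n%:R%:E)%E].
Proof.
move=> mB.
rewrite [X in measurable X](_ : _ = (fun C : config R d => config_count C B) @^-1` `]-oo, n%:R%:E]).
  rewrite -[X in measurable X]setTI; apply: measurable_config_count => //.
  exact: emeasurable_itv.
by apply/seteqP; split => C; rewrite /= in_itv.
Qed.

Lemma config_count_shift z C B :
  config_count (shift_config z C) B = config_count C [set x | B (x + z)].
Proof.
rewrite /config_count /counting.
have -> : shift_config z C `&` B = +%R^~ z @` (C `&` [set x | B (x + z)]).
  apply/seteqP; split => [_ [[x Cx <-] Bx]|_ [x [Cx Bx] <-]].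
    by exists x.
  by split => //; exists x.
have zI : injective (fun x => x + z) by exact: addIr.
have [fC|fC] := pselect (finite_set (C `&` [set x | B (x + z)])).
  rewrite !asboolT//; last exact: finite_image.
  rewrite fset_set_image// card_imfset//.
rewrite !asboolF// => fI; apply: fC.
apply: sub_finite_set (finite_image (+%R^~ (- z)) fI).
by move=> x Cx; exists (x + z); [exists x|rewrite addrK].
Qed.

Lemma measurable_eball (x : 'rV[R]_d) r : measurable (eball x r).
Proof.
have -> : eball x r = [set y | edist y x <= r].
  by apply/seteqP; split => y; rewrite /eball/= edistC.
by apply: measurable_ler => //; exact: (@measurable_edist R d _ _ id).
Qed.

Lemma measurable_eball_tuple k (x : 'M[R]_(k, d)) r : measurable (eball_tuple x r).
Proof.
apply: countable_bigcupT_measurable => [|i]; first exact: countableP.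
exact: measurable_eball.
Qed.

(** With the balls of radius e around the rows of q disjoint and s >= e, these are
    the configurations with exactly one point in each of them and no other point
    within s of q. *)
Definition cluster_event k (q : 'M[R]_(k, d)) (e s : R) : set (config R d) :=
  [set C : config R d | (forall i, C `&` eball (row i q) e !=set0) /\
           (config_count C (eball_tuple q s) <= k%:R%:E)%E].

Lemma measurable_cluster_event k (q : 'M[R]_(k, d)) e s :
  measurable (cluster_event q e s).
Proof.
have -> : cluster_event q e s =
    (\bigcap_(i in [set: 'I_k]) ~` [set C : config R d | C `&` eball (row i q) e = set0])
    `&` [set C : config R d | (config_count C (eball_tuple q s) <= k%:R%:E)%E].
  apply/seteqP; split => C [h1 h2]; split => //.
    by move=> i _ /=; apply/eqP/set0P.
  by move=> i; apply/set0P/eqP; exact: h1.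
apply: measurableI; last first.
  by apply: measurable_config_count_le; exact: measurable_eball_tuple.
apply: fin_bigcap_measurable => // i _; apply: measurableC.
by apply: measurable_config_void; exact: measurable_eball.
Qed.

Lemma row_shift_tuple k z (x : 'M[R]_(k, d)) i :
  row i (shift_tuple z x) = row i x + z.
Proof. by apply/rowP => j; rewrite !mxE. Qed.

Lemma edistD z x y : edist (x + z) (y + z) = edist x y :> R.
Proof. by have := edist_affine z x y (@ler01 R); rewrite !scale1r mul1r. Qed.

Lemma eball_tuple_shift k z (x : 'M[R]_(k, d)) r :
  [set y | eball_tuple (shift_tuple z x) r (y + z)] = eball_tuple x r.
Proof.
apply/seteqP; split => y [i _]; rewrite /eball/= => h; exists i => //;
by move: h; rewrite row_shift_tuple /eball/= edistD.
Qed.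

Lemma shift_cluster_event k z (q : 'M[R]_(k, d)) e s C :
  cluster_event (shift_tuple z q) e s (shift_config z C) <->
  cluster_event q e s C.
Proof.
rewrite /cluster_event/= config_count_shift eball_tuple_shift.
split => -[h1 h2]; split => // i.
- have [_ [[x Cx <-]]] := h1 i.
  by rewrite row_shift_tuple /eball/= edistD => ?; exists x.
- have [x [Cx xq]] := h1 i; exists (x + z); split; first by exists x.
  by rewrite row_shift_tuple /eball/= edistD.
Qed.

Lemma stationary_cluster_event disp (Omega : measurableType disp)
    (P : probability Omega R) (Phi : {mfun Omega >-> config R d}) k z
    (q : 'M[R]_(k, d)) e s : stationary P Phi ->
  P (Phi @^-1` cluster_event (shift_tuple z q) e s) =
  P (Phi @^-1` cluster_event q e s).
Proof.
move=> sP; rewrite -(sP z); last exact: measurable_cluster_event.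
by congr (P _); apply/seteqP; split => w /= /shift_cluster_event.
Qed.

End counting_events.

(** * Compactness and local finiteness *)

Section compact_boxes.
Context (R : realType) (k d : nat).

(** Used to transport compactness from row vectors to matrices. *)
Lemma vec_mx_continuous : continuous (@vec_mx R k d).
Proof.
move=> v A [B vB BA].
(* l is the index of a single pair (i, j), so the quantifiers are harmless *)
exists (fun _ l => [set t | forall i j, mxvec_index i j = l -> B i j t]).
  move=> o l; case/mxvec_indexP: l => i j.
  have := vB i j; rewrite mxE (ord1 o); apply: filterS => t Bt i' j' ij.
  have [g gK _] := curry_mxvec_bij k d.
  have := gK (i', j') isT; rewrite /= ij.
  by have := gK (i, j) isT; rewrite /= => -> [<- <-].
move=> w wB; apply: BA => i j; rewrite mxE; exact: wB.
Qed.

Lemma compact_mx_box (M : R) :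
  compact [set x : 'M[R]_(k, d) | forall i j, `|x i j| <= M].
Proof.
have -> : [set x : 'M[R]_(k, d) | forall i j, `|x i j| <= M] = vec_mx @`
    [set v : 'rV[R]_(k * d) | forall l, (`[- M, M]%classic) (v ord0 l)].
  apply/seteqP; split => [x xM|_ [v vM <-] i j]; last first.
    by rewrite mxE; have := vM (mxvec_index i j); rewrite /= in_itv/= ler_norml.
  exists (mxvec x); last exact: mxvecK.
  move=> l; case/mxvec_indexP: l => i j.
  by rewrite mxvecE/= in_itv/= -ler_norml; exact: xM.
apply: (@continuous_compact 'rV[R]_(k * d) 'M[R]_(k, d) vec_mx).
  exact/continuous_subspaceT/vec_mx_continuous.
by apply: (@rV_compact R (k * d) (fun=> `[- M, M]%classic)) => _;
  exact: segment_compact.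
Qed.

Lemma bounded_set_coord (B : set 'M[R]_(k, d)) (M : R) :
  (forall x, B x -> forall i j, `|x i j| <= M) -> bounded_set B.
Proof.
move=> BM; exists (Num.max M 0); split; first by rewrite num_real.
move=> N; rewrite gt_max => /andP[MN N0] x Bx /=.
have [->|x0] := eqVneq x 0; first by rewrite normr0 ltW.
have /mx_norm_neq0[[i j] e] : mx_norm x != 0.
  by apply: contra x0 => /eqP/mx_norm_eq0 ->.
rewrite [leLHS](_ : _ = `|x i j|) ?e//.
exact: le_trans (BM _ Bx i j) (ltW MN).
Qed.

End compact_boxes.

Section cluster_points.
Context (R : realType) (d : nat).
Implicit Types (C : config R d).

Lemma counting_range n (T : choiceType) (f : 'I_n -> T) (A : set T) :
  A `<=` range f -> (@counting T R A <= n%:R%:E)%E.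
Proof.
move=> Af.
have fA : finite_set A.
  by apply: sub_finite_set Af _; apply: finite_image; exact: finite_finset.
rewrite /counting asboolT// lee_fin ler_nat.
apply: (@leq_trans #|` [fset f i | i in 'I_n]%fset|).
  apply: fsubset_leq_card; apply/fsubsetP => x; rewrite in_fset_set// inE.
  by move=> /Af[i _ <-]; apply/imfsetP; exists i.
by rewrite (leq_trans (leq_imfset_card _ _ _))//= size_enum_ord.
Qed.

Lemma add_points_count k C (x : 'M[R]_(k, d)) B : C `&` B = set0 ->
  (config_count (add_points C x) B <= k%:R%:E)%E.
Proof.
move=> CB0; apply: (counting_range (f := fun i => row i x)).
move=> y [[Cy By|xy _]]//.
by have : (C `&` B) y by []; rewrite CB0.
Qed.

Lemma bounded_eball_tuple k (x : 'M[R]_(k, d)) r : bounded_set (eball_tuple x r).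
Proof.
have : exists M, forall i j, `|x i j| <= M.
  exists (\sum_i \sum_j `|x i j|) => i j.
  rewrite (bigD1 i)//= (bigD1 j)//= -addrA lerDl addr_ge0 ?sumr_ge0// => *.
  exact: sumr_ge0.
move=> [M xM]; apply: (@bounded_set_coord _ _ _ _ (M + r)) => y [i _ xy] l j.
rewrite (ord1 l).
have := coord_le_edist (row i x) y j; rewrite mxE => xyj.
have xr : edist (row i x) y <= r := xy.
have -> : y 0 j = x i j - (x i j - y 0 j) by rewrite opprB addrC subrK.
rewrite (le_trans (ler_normB _ _))// lerD//.
exact: le_trans xr.
Qed.

(** A locally finite configuration that avoids a closed ball avoids a slightly
    larger one. *)
Lemma void_robust k C (x : 'M[R]_(k, d)) (b : R) :
  C `&` eball_tuple x b = set0 ->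
  exists2 e : R, 0 < e & C `&` eball_tuple x (b + e) = set0.
Proof.
move=> Cx0; have fC : finite_set (C `&` eball_tuple x (b + 1)).
  exact/config_locally_finite/bounded_eball_tuple.
pose F := fset_set (C `&` eball_tuple x (b + 1)).
have [|e e0 eF] := @finite_min_gt0 R (F * 'I_k)%type finset.setT
    (fun pi => edist (row pi.2 x) (val pi.1) - b).
  move=> [p i] _ /=; rewrite subr_gt0 ltNge; apply/negP => pb.
  have := fsvalP p; rewrite in_fset_set// inE => -[Cp _].
  by have : (C `&` eball_tuple x b) (fsval p); [split => //; exists i|rewrite Cx0].
exists (Num.min (e / 2) 1); first by rewrite lt_min ltr01 divr_gt0.
apply/seteqP; split => // p [Cp [i _ xp]].
have {}xp : edist (row i x) p <= b + Num.min (e / 2) 1 := xp.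
have pF : p \in F.
  rewrite in_fset_set// inE; split => //; exists i => //.
  by apply: (le_trans xp); rewrite lerD2l ge_min lexx orbT.
have := eF (FSetSub pF, i) (finset.in_setT _); rewrite /= lerBrDl.
move=> h; have := le_trans h xp; rewrite lerD2l le_min => /andP[].
by move=> ee; exfalso; move: ee; apply/negP; rewrite -ltNge; lra.
Qed.

End cluster_points.

(** * Consequences of the Palm formula *)

Section relative.
Context (R : realType) (d : nat).

Lemma with_origin0 m (y : 'M[R]_(m, d)) j : with_origin y ord0 j = 0.
Proof.
have := col_mxEu (0 : 'rV[R]_d) y ord0 j; rewrite [RHS]mxE => <-.
by congr (fun_of_matrix _ _ _); exact/val_inj.
Qed.

Lemma with_originS m (y : 'M[R]_(m, d)) l j :
  with_origin y (lift ord0 l) j = y l j.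
Proof.
have := col_mxEd (0 : 'rV[R]_d) y l j => <-.
by congr (fun_of_matrix _ _ _); exact/val_inj.
Qed.

Lemma relative_rowsK m (b : R) (x : 'M[R]_(m.+1, d)) : b != 0 ->
  x = shift_tuple (row ord0 x) (b *: with_origin (relative_rows b x)).
Proof.
move=> b0; apply/matrixP => i j.
have -> y : shift_tuple (row ord0 x) (b *: y) i j = b * y i j + x ord0 j.
  by rewrite !mxE.
case: (unliftP ord0 i) => [l ->|->]; last by rewrite with_origin0 mulr0 add0r.
by rewrite with_originS mxE mulVKf// subrK.
Qed.

Lemma balls_meet_shift_scale k (z : 'rV[R]_d) (b : R) (x : 'M[R]_(k, d)) S s :
  0 < b ->
  balls_meet (shift_tuple z (b *: x)) S (b * s) <-> balls_meet x S s.
Proof.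
move=> b0.
have e i q : edist (row i (shift_tuple z (b *: x))) (b *: q + z) =
    b * edist (row i x) q.
  by rewrite row_shift_tuple row_scale edist_affine// ltW.
split => -[q qs].
  exists (b^-1 *: (q - z)) => i /qs qsi; rewrite -(ler_pM2l b0) -e.
  by rewrite scalerA mulfV ?gt_eqF// scale1r subrK.
by exists (b *: q + z) => i /qs; rewrite e ler_pM2l.
Qed.

Lemma translation_covariant_void k (palm : R.-pker 'M[R]_(k, d) ~> config R d)
    (z : 'rV[R]_d) (x : 'M[R]_(k, d)) b : translation_covariant palm ->
  palm (shift_tuple z x) [set C | C `&` eball_tuple (shift_tuple z x) b = set0] =
  palm x [set C | C `&` eball_tuple x b = set0].
Proof.
move=> ->; last by apply: measurable_config_void; exact: measurable_eball_tuple.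
have e C : shift_config z C `&` eball_tuple (shift_tuple z x) b = set0 <->
    C `&` eball_tuple x b = set0.
  have := config_count_eq0 (shift_config z C) (eball_tuple (shift_tuple z x) b).
  by rewrite config_count_shift eball_tuple_shift => <-; exact: config_count_eq0.
by congr (palm x _); apply/seteqP; split => C /e.
Qed.

End relative.

Lemma countable_cover_not_null (R : realType) dT (T : measurableType dT)
    (mu : {measure set T -> \bar R}) (I : countType) (X : set T)
    (Y : I -> set T) :
  measurable X -> (forall i, measurable (Y i)) -> X `<=` \bigcup_i Y i ->
  mu X != 0%E -> exists i, mu (Y i) != 0%E.
Proof.
move=> mX mY XY muX; apply: contrapT => /forallNP Y0.
move/eqP: muX; apply.
pose Z n := if choice.unpickle n is Some i then Y i else set0.
have mZ n : measurable (Z n) by rewrite /Z; case: choice.unpickle.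
have Z0 n : mu (Z n) = 0%E.
  rewrite /Z; case: choice.unpickle => [i|]; last exact: measure0.
  by apply/eqP; apply: contrapT => /negP; exact: Y0.
have XZ : X `<=` \bigcup_n Z n.
  by move=> x /XY[i _ Yi]; exists (choice.pickle i) => //; rewrite /Z choice.pickleK.
apply/eqP; rewrite -measure_le0.
apply: (le_trans (measure_sigma_subadditive _ mZ mX XZ)).
by rewrite eseries0.
Qed.

Section palm.
Context (R : realType) (d : nat) (disp : measure_display)
  (Omega : measurableType disp) (P : probability Omega R)
  (Phi : {mfun Omega >-> config R d}).
(** Apply the Palm formula to the indicator function of the pairs made of a tuple
    of X and of a configuration with at most k points around q. Adding the
    points of the tuple to a configuration that is empty around q produces such
    a pair, hence the right-hand side is positive. On the left-hand side, a
    tuple of X provides a point near each row of q. *)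
Lemma palm_cluster_event k (rho : 'M[R]_(k, d) -> R)
    (palm : R.-pker 'M[R]_(k, d) ~> config R d) (q : 'M[R]_(k, d)) (e s : R)
    (X : set 'M[R]_(k, d)) :
  (0 < k)%N -> is_joint_intensity P Phi rho ->
  is_reduced_palm P Phi rho palm ->
  measurable X -> mx_lebesgue R k d X != 0%E ->
  (forall x, X x -> forall i, edist (row i q) (row i x) <= e) ->
  (forall x, X x -> 0 < rho x) ->
  (forall x, X x -> 0 < palm x [set C | C `&` eball_tuple q s = set0])%E ->
  (0 < P (Phi @^-1` cluster_event q e s))%E.
Proof.
move=> k_gt0 [mrho rho0 _ _] palmP mX X0 Xq Xrho Xpalm.
pose Q := eball_tuple q s.
have mQ : measurable Q by exact: measurable_eball_tuple.
pose H := [set C : config R d | (config_count C Q <= k%:R%:E)%E].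
have mH : measurable H by exact: measurable_config_count_le.
pose u (p : config R d * 'M[R]_(k, d)) : R := \1_(H `*` X) p.
have mHX : measurable (H `*` X) by exact: measurableX.
have mu : measurable_fun setT u by exact: measurable_indic.
have ux C x : X x -> H C -> u (C, x) = 1.
  by move=> Xx HC; rewrite /u indicE mem_set.
have u0 C x : ~ X x -> u (C, x) = 0.
  by move=> Xx; rewrite /u indicE memNset// => -[].
have [K [cK XK]] : exists K : set 'M[R]_(k, d), compact K /\ X `<=` K.
  exists [set x | forall i j, `|x i j| <= \sum_i \sum_j `|q i j| + e].
  split; first exact: compact_mx_box.
  move=> x Xx i j; have := coord_le_edist (row i q) (row i x) j.
  rewrite !mxE => qx.
  have -> : x i j = q i j - (q i j - x i j) by rewrite opprB addrC subrK.
  rewrite (le_trans (ler_normB _ _))// lerD//; last exact: le_trans qx (Xq _ Xx i).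
  rewrite (bigD1 i)//= (bigD1 j)//= -addrA lerDl addr_ge0 ?sumr_ge0// => *.
  exact: sumr_ge0.
have u_ge0 p : 0 <= u p by rewrite /u indicE.
have u_le1 : exists M, forall p, u p <= M.
  by exists 1 => p; rewrite /u indicE lern1 leq_b1.
have uK : exists K : set 'M[R]_(k, d), compact K /\
    forall C x, ~ K x -> u (C, x) = 0.
  by exists K; split => // C x Kx; apply: u0 => /XK.
have := palmP u mu u_ge0 u_le1 uK.
set F := fun w => (\esum_(x in distinct_tuples k (Phi w)) (u (Phi w, x))%:E)%E.
set G := fun x => (_ * (rho x)%:E)%E.
move=> FG.
pose g x : \bar R := ((\1_X x)%:E *
  (palm x [set C | C `&` Q = set0] * (rho x)%:E))%E.
have g0 x : (0 <= g x)%E.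
  by rewrite /g !mule_ge0// lee_fin// rho0.
have mg : measurable_fun setT g.
  apply: emeasurable_funM; first exact/measurable_EFinP/measurable_indic.
  apply: emeasurable_funM; last exact/measurable_EFinP.
  by apply: measurable_kernel; exact: measurable_config_void.
have gG x : (g x <= G x)%E.
  have G0 : (0 <= G x)%E.
    by rewrite /G mule_ge0 ?lee_fin//; apply: integral_ge0 => C _; rewrite lee_fin.
  have [Xx|Xx] := pselect (X x); last by rewrite /g indicE memNset// mul0e.
  rewrite /g /G indicE mem_set// mul1e lee_pmul// ?lee_fin//.
  pose V := [set C : config R d | C `&` Q = set0].
  have mV : measurable V by exact: measurable_config_void.
  have -> : palm x V = (\int[palm x]_C (\1_V C)%:E)%E.
    by rewrite integral_indic// setIT.
  apply: ge0_le_lower_integral => C; first by rewrite lee_fin.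
  rewrite lee_fin indicE; have [/set_mem VC|_] := boolP (C \in V) => //.
  by rewrite ux//; exact: add_points_count.
have G_gt0 : (0 < \int[mx_lebesgue R k d]_x G x)%E.
  apply: lt_le_trans (ge0_le_lower_integral _ g0 gG).
  rewrite lt0e integral_ge0// andbT; apply: contra X0 => /eqP.
  move/(ge0_integral_eq0P _ mg g0).1 => gN0.
  apply/eqP; apply: (subset_measure0 _ _ _ gN0) => //.
    by rewrite -[X in measurable X]setTI; exact: emeasurable_neq.
  move=> x Xx /=; rewrite gt_eqF// /g indicE mem_set// mul1e.
  by rewrite mule_gt0 ?lte_fin ?Xrho// Xpalm.
have F0 w : (0 <= F w)%E.
  by apply: esum_ge0 => x _; rewrite lee_fin /u indicE.
rewrite -FG in G_gt0.
have [E [mE PE EF]] := integral_gt0_measurable_subset F0 G_gt0.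
have mC : measurable (Phi @^-1` cluster_event q e s).
  by rewrite -[X in measurable X]setTI; apply: (measurable_funP Phi) => //;
    exact: measurable_cluster_event.
rewrite lt0e measure_ge0 andbT; apply: contra PE => /eqP PC0; apply/eqP.
apply: (subset_measure0 _ _ _ PC0) => // w /EF.
rewrite /F; apply: contraPP => nC; rewrite esum1 ?ltxx//.
move=> x [xPhi _]; rewrite /u indicE memNset// => -[/= HC Xx].
apply: nC; split => // i; exists (row i x); split; first exact: xPhi.
exact: Xq.
Qed.

End palm.

(** * Isolated clusters with positive probability *)

Section isolated_clusters.
Context (R : realType) (d : nat).

(** The second clause makes the balls of radius e around the rows of q disjoint,
    so that points chosen in each of them are distinct. *)
Definition stable_near k (q : 'M[R]_(k, d)) (e b : R) (y : 'M[R]_(k, d)) :=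
  (forall x (s : R), (forall i, edist (row i q) (row i x) <= e) ->
    `|s - b| <= e ->
    forall S, balls_meet x S (s / 2) <-> balls_meet y S (1 / 2)) /\
  (forall i j p, edist (row i q) p <= e -> edist (row j q) p <= e -> i = j).

(** The margins are finitely many: one for each set of rows, for the pattern, and
    one for each pair of rows, for disjointness. The constants leave room for
    replacing x by a point q within e'. *)
Lemma stable_near_generic m (b : R) (x : 'M[R]_(m.+1, d)) : 0 < b ->
  (forall S, ~ critical S (b / 2) x) ->
  injective (fun i => row i (with_origin (relative_rows b x))) ->
  exists2 e : R, 0 < e & forall q e', e' <= e ->
    (forall i, edist (row i x) (row i q) <= e') ->
    stable_near q e' b (with_origin (relative_rows b x)).
Proof.
move=> b0 xcrit yI; set y := with_origin _.
have xE : x = shift_tuple (row ord0 x) (b *: y).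
  by apply: relative_rowsK; rewrite gt_eqF.
have /choice[f fP] : forall S, exists e : R, 0 < e /\ forall x' s',
    (forall i, edist (row i x) (row i x') <= e) -> `|s' - b / 2| <= e ->
    (balls_meet x' S s' <-> balls_meet x S (b / 2)).
  by move=> S; have [e e0 eP] := balls_meet_robust (xcrit S); exists e.
have [|e1 e10 e1f] := @finite_min_gt0 R _ finset.setT f.
  by move=> S _; exact: (fP S).1.
have [|e2 e20 e2x] := @finite_min_gt0 R ('I_m.+1 * 'I_m.+1)%type
    [set p | p.1 != p.2]%SET (fun p => edist (row p.1 x) (row p.2 x)).
  move=> [i j]; rewrite inE/= => ij; rewrite lt0r edist_ge0 andbT.
  apply: contra ij => /eqP/edist_eq0.
  rewrite xE !row_shift_tuple !row_scale => /addIr/scalerI.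
  by move=> /(_ (lt0r_neq0 b0)) /yI ->.
exists (Num.min (e1 / 2) (e2 / 5)); first by rewrite lt_min !divr_gt0.
move=> q e; rewrite le_min => /andP[ee1 ee2] xq; split.
- move=> x' s qx' sb S.
  have sE : b / 2 = b * (1 / 2) by rewrite mulrA mulr1.
  have := balls_meet_shift_scale (row ord0 x) y S (1 / 2) b0.
  rewrite -sE -xE => <-; apply: (fP S).2.
    move=> i; apply: (le_trans (edist_triangle (row i q) _ _)).
    apply: le_trans (e1f S (finset.in_setT _)).
    have := xq i; have := qx' i; lra.
  rewrite -mulrBl normrM [X in _ * X]ger0_norm//.
  apply: le_trans (e1f S (finset.in_setT _)).
  lra.
- move=> i j p qip qjp; apply/eqP/negPn/negP => ij.
  have := e2x (i, j); rewrite inE => /(_ ij)/=.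
  have h1 := edist_triangle (row i q) (row i x) (row j x).
  have h2 := edist_triangle p (row i q) (row j x).
  have h3 := edist_triangle (row j q) p (row j x).
  have := xq i; have := xq j; rewrite (edistC (row j x) (row j q)).
  rewrite (edistC p (row j q)) in h3.
  lra.
Qed.

Context (disp : measure_display)
  (Omega : measurableType disp) (P : probability Omega R)
  (Phi : {mfun Omega >-> config R d}).

(** Each generic tuple of positive density is near a rational q such that the
    pattern is stable and that an empty neighbourhood of q has positive Palm
    probability. There are countably many pairs (q, e), so one of them captures
    a set of tuples of positive measure, to which the Palm formula applies. *)
Lemma cluster_event_gt0 (rho : forall k, 'M[R]_(k, d) -> R)
    (palm : forall k, R.-pker 'M[R]_(k, d) ~> config R d) (beta : R) m
    (A : set 'M[R]_(m, d)) (b := beta `^ d%:R^-1) :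
  0 < beta -> is_joint_intensity P Phi (rho m.+1) ->
  translation_invariant (rho m.+1) ->
  is_reduced_palm P Phi (rho m.+1) (palm m.+1) ->
  translation_covariant (palm m.+1) ->
  (forall y, A y -> injective (fun i => row i (with_origin y))) ->
  (0 < gamma_integral rho palm beta A)%E ->
  exists y (q : 'M[R]_(m.+1, d)) (e : R),
    [/\ A y, 0 < e, stable_near q e b (with_origin y) &
        (0 < P (Phi @^-1` cluster_event q e (b + 3 * e)))%E].
Proof.
move=> beta0 irho trho ipalm tpalm AI gA.
have b0 : 0 < b by rewrite powR_gt0.
have [mrho rho0 _ _] := irho.
pose f y := ((\1_A y)%:E * gamma_density rho palm beta y)%E.
have f0 y : (0 <= f y)%E.
  by rewrite /f /gamma_density !mule_ge0// lee_fin// rho0.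
have intf : (0 < \int[mx_lebesgue R m d]_y f y)%E.
  rewrite lt0e integral_ge0// andbT; apply: contraTN gA => /eqP f_eq0.
  by rewrite /gamma_integral -/f f_eq0 mule0 ltxx.
have [E [mE muE Ef]] := integral_gt0_measurable_subset f0 intf.
have EA y : E y -> A y.
  move=> /Ef; apply: contraPP => Ay.
  by rewrite /f indicE memNset// mul0e ltxx.
have Ed y : E y -> (0 < gamma_density rho palm beta y)%E.
  move=> Ey; have := Ef _ Ey; rewrite /f indicE mem_set ?mul1e//; exact: EA.
pose X := @relative_rows R m d b @^-1` E `\`
  \bigcup_(S in [set: {set 'I_m.+1}]) critical S (b / 2).
have mX1 : measurable (@relative_rows R m d b @^-1` E).
  by rewrite -[X in measurable X]setTI; exact: measurable_relative_rows.
have mcrit : measurable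
    (\bigcup_(S in [set: {set 'I_m.+1}]) @critical R m.+1 d S (b / 2)).
  apply: countable_bigcupT_measurable => [|S]; first exact: countableP.
  exact: measurable_critical.
have mX : measurable X by exact: measurableD.
have X0 : mx_lebesgue R m.+1 d X != 0%E.
  have crit0 : mx_lebesgue R m.+1 d
      (\bigcup_(S in [set: {set 'I_m.+1}]) critical S (b / 2)) = 0%E.
    apply/eqP/negPn/negP => nz.
    have [S] := countable_cover_not_null mcrit
      (fun S => measurable_critical S (b / 2)) (@subset_refl _ _) nz.
    by move/eqP; apply; apply: critical_null; rewrite divr_gt0.
  apply: contra (mx_lebesgue_relative_rows b0 mE muE) => /eqP XX0; apply/eqP.
  have U0 : mx_lebesgue R m.+1 d (X `|` \bigcup_(S in [set: {set 'I_m.+1}])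
      critical S (b / 2)) = 0%E by rewrite measureU0.
  apply: (subset_measure0 _ _ _ U0) => //.
  - exact: measurableU.
  - move=> x Ex; have [xc|xc] := pselect ((\bigcup_(S in [set: {set 'I_m.+1}])
      @critical R m.+1 d S (b / 2)) x); first by right.
    by left.
have Xsplit x : X x -> [/\ E (relative_rows b x), 0 < rho m.+1 x &
    (0 < palm m.+1 x [set C | C `&` eball_tuple x b = set0])%E].
  move=> [Ex _]; have xE := relative_rowsK x (lt0r_neq0 b0).
  set y := relative_rows b x in xE Ex *.
  have := Ed _ Ex; rewrite /gamma_density/= -/b.
  set v := palm _ _ _ => yd.
  have rhoE : rho m.+1 x = rho m.+1 (b *: with_origin y) by rewrite xE trho.
  have vE : palm m.+1 x [set C | C `&` eball_tuple x b = set0] = v.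
    by rewrite xE translation_covariant_void.
  rewrite rhoE vE; split => //.
    rewrite lt0r rho0 andbT; apply/eqP => r0.
    by move: yd; rewrite r0 mul0e ltxx.
  rewrite lt0e measure_ge0 andbT; apply/eqP => v0.
  by move: yd; rewrite v0 mule0 ltxx.
(* q is rational and e is the inverse of a positive integer; the choices for
   which the pattern is not stable are discarded. *)
pose Y (c : 'M[rat]_(m.+1, d) * nat) : set 'M[R]_(m.+1, d) :=
  let q := map_mx ratr c.1 in let e : R := c.2.+1%:R^-1 in
  if `[< exists2 y, A y & stable_near q e b (with_origin y) >] then
    X `&` (\bigcap_(i in [set: 'I_m.+1]) [set x | edist (row i x) (row i q) <= e])
      `&` [set x | (0 < palm m.+1 x
             [set C : config R d | C `&` eball_tuple q (b + 3 * e) = set0])%E]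
  else set0.
have mY c : measurable (Y c).
  rewrite /Y; case: ifPn => // _.
  apply: measurableI.
    apply: measurableI => //; apply: fin_bigcap_measurable => // i _.
    apply: measurable_ler => //; apply: measurable_edist; exact: measurable_row.
  rewrite -[X in measurable X]setTI; apply: emeasurable_fun_o_infty => //.
  apply: measurable_kernel; apply: measurable_config_void.
  exact: measurable_eball_tuple.
have XY : X `<=` \bigcup_c Y c.
  move=> x Xx; have [Ex _ px] := Xsplit _ Xx.
  have [|e1 e10 e1P] := stable_near_generic b0 _ (AI _ (EA _ Ex)).
    by move=> S xS; apply: Xx.2; exists S.
  pose V n := [set C : config R d | C `&` eball_tuple x (b + n.+1%:R^-1) = set0].
  have mV n : measurable (V n).
    by apply: measurable_config_void; exact: measurable_eball_tuple.
  have mV0 : measurable [set C : config R d | C `&` eball_tuple x b = set0].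
    by apply: measurable_config_void; exact: measurable_eball_tuple.
  have {}px : palm m.+1 x [set C | C `&` eball_tuple x b = set0] != 0%E.
    by rewrite gt_eqF.
  have [|n Vn] := countable_cover_not_null (mu := palm m.+1 x) mV0 mV _ px.
    move=> C /void_robust[e e0 Ce]; have [n ne] := invn_lt e0.
    exists n => //=; apply/seteqP; split => // p [Cp xp].
    rewrite -Ce; split => //; move: xp => [i _ xp]; exists i => //.
    by apply: (le_trans xp); rewrite lerD2l ltW.
  have [|l] := @invn_lt R (Num.min e1 (n.+1%:R^-1 / 4)).
    by rewrite lt_min e10/= divr_gt0.
  pose e : R := l.+1%:R^-1; rewrite -/e lt_min => /andP[ee1 en].
  have e0 : 0 < e by rewrite invr_gt0.
  have [q xq] := rat_approx x e0.
  exists (q, l) => //; rewrite /Y/= asboolT; last first.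
    exists (relative_rows b x); first exact: EA.
    by apply: e1P; [exact: ltW|move=> i; exact: ltW].
  split; first by split => // i _ /=; exact: ltW.
  rewrite /=; apply: (@lt_le_trans _ _ (palm m.+1 x (V n))).
    by rewrite lt0e Vn measure_ge0.
  apply: le_measure; rewrite ?inE//.
    by apply: measurable_config_void; exact: measurable_eball_tuple.
  move=> C /= Cn; apply/seteqP; split => // p [Cp [i _ qp]].
  rewrite -Cn; split => //; exists i => //.
  apply: (le_trans (edist_triangle (row i (map_mx ratr q)) _ _)).
  have := xq i; have : edist (row i (map_mx ratr q)) p <= b + 3 * e := qp.
  move: en; clearbody e; move: (n.+1%:R^-1 : R) => N; lra.
have [[q n]] := countable_cover_not_null mX mY XY X0.
rewrite /Y/=; case: asboolP => [[y Ay yq] Yc|]; last by rewrite measure0 eqxx.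
exists y, (map_mx ratr q), n.+1%:R^-1; split => //.
have := mY (q, n); rewrite /Y/= asboolT; last by exists y.
move=> mYc.
apply: (palm_cluster_event (ltn0Sn m) irho ipalm mYc Yc) => [x [[_ xq] _] i||x [_]//].
- by rewrite edistC; exact: xq.
- by move=> x [[Xx _] _]; have [] := Xsplit _ Xx.
Qed.

End isolated_clusters.

(** * Complexes defined by intersections of balls *)

Section ball_complexes.
Context (R : realType) (d : nat).

Definition index_cech k (x : 'M[R]_(k, d)) (s : R) : complex 'I_k :=
  [set S : {set 'I_k} | (S != finset.set0) && `[< balls_meet x S s >]]%SET.

(** Membership involves pairs only, so that this complex is a function of the
    pattern of intersecting balls, as the Cech complex is. *)
Definition index_rips k (x : 'M[R]_(k, d)) (s : R) : complex 'I_k :=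
  [set S : {set 'I_k} | (S != finset.set0) &&
    [forall i in S, forall j in S, `[< balls_meet x [set i; j]%SET s >]]]%SET.

(** The common features of the Cech and Vietoris-Rips constructions on which the
    bounds rest. *)
Definition ball_complex (cplx : forall P : {fset 'rV[R]_d}, R -> complex P)
    (index : forall k, 'M[R]_(k, d) -> R -> complex 'I_k) :=
  [/\ forall (P : {fset 'rV[R]_d}) r, hereditary (cplx P r),
      forall (P : {fset 'rV[R]_d}) r s (u v : P), s \in cplx P r -> u \in s -> v \in s ->
        edist (val u) (val v) <= r,
      forall (P : {fset 'rV[R]_d}) r k (x : 'M[R]_(k, d)) (g : 'I_k -> P), injective g ->
        (forall i, val (g i) = row i x) ->
        embeds (cplx P r) (index k x (r / 2)) g,
      forall k (x y : 'M[R]_(k, d)) s t,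
        (forall S, balls_meet x S s <-> balls_meet y S t) ->
        index k x s = index k y t &
      forall k (x : 'M[R]_(k, d)) i s, 0 <= s -> [set i]%SET \in index k x s].

Lemma cech_ball_complex : ball_complex (@cech R d) index_cech.
Proof.
split.
- move=> P r s t; rewrite !inE => /andP[_ /asboolP[p ps]] ts ->/=.
  by apply/asboolP; exists p => u /= ut; apply: ps => /=; exact: (fintype.subsetP ts).
- move=> P r s u v; rewrite inE => /andP[_ /asboolP[p ps]] us vs.
  by apply/eball_meetP; exists p; split; exact: ps.
- move=> P r k x g gI gx; split => // S; rewrite !inE.
  rewrite imset_eq0; congr (_ && _); apply: asbool_equiv_eq.
  split=> -[p pS]; exists p.
    by move=> i iS; rewrite -gx; apply: pS => /=; exact: imset_f.
  by move=> _ /= /imsetP[i iS ->]; rewrite /eball/= gx; exact: pS.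
- move=> k x y s t xy; apply/finset.setP => S; rewrite !inE.
  by congr (_ && _); apply: asbool_equiv_eq.
- move=> k x i s s0; rewrite inE -card_gt0 cards1/=; apply/asboolP.
  by exists (row i x) => j; rewrite inE => /eqP ->; rewrite edistxx.
Qed.

Lemma rips_ball_complex : ball_complex (@rips R d) index_rips.
Proof.
split.
- move=> P r s t; rewrite !inE => /andP[_ /asboolP ps] ts ->/=.
  by apply/asboolP => u v ut vt; apply: ps; exact: (fintype.subsetP ts).
- move=> P r s u v; rewrite inE => /andP[_ /asboolP ps] us vs.
  by apply/eball_meetP; exact: ps.
- move=> P r k x g gI gx; split => // S; rewrite !inE.
  rewrite imset_eq0; congr (_ && _).
  apply/asboolP/forall_inP => [ps i iS|ps _ _ /imsetP[i iS ->] /imsetP[j jS ->]].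
    apply/forall_inP => j jS; apply/asboolP.
    have [p [ip jp]] := ps (g i) (g j) (imset_f g iS) (imset_f g jS).
    exists p => l; rewrite !inE => /orP[]/eqP->; rewrite -gx; [exact: ip|exact: jp].
  have /forall_inP/(_ j jS)/asboolP[p pij] := ps i iS.
  by exists p; split; rewrite /eball/= gx; apply: pij; rewrite !inE eqxx ?orbT.
- move=> k x y s t xy; apply/finset.setP => S; rewrite !inE.
  congr (_ && _); apply: eq_forallb => i; congr (_ ==> _).
  by apply: eq_forallb => j; congr (_ ==> _); apply: asbool_equiv_eq.
- move=> k x i s s0; rewrite inE -card_gt0 cards1/=.
  apply/forall_inP => j; rewrite inE => /eqP->.
  apply/forall_inP => l; rewrite inE => /eqP->.
  apply/asboolP; exists (row i x) => j'; rewrite !inE orbb => /eqP{j'}->.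
  by rewrite edistxx.
Qed.

Section tuple_points.
Context (k : nat) (x : 'M[R]_(k, d)).

Definition tuple_point (i : 'I_k) : tuple_points x :=
  FSetSub (in_imfset imfset_key (fun i => row i x) (isT : i \in 'I_k)).

Lemma tuple_point_surj u : exists i, u = tuple_point i.
Proof.
have /imfsetP[i _ ui] := fsvalP u; exists i; exact/val_inj.
Qed.

(** Rows that coincide would leave fewer than k points; the isomorphism types in
    the definitions of gamma fix the number of points, hence exclude this. *)
Lemma tuple_points_inj : (k <= #|{: tuple_points x}|)%N ->
  injective (fun i => row i x).
Proof.
move=> kx; have : #|image_mem tuple_point (mem 'I_k)| == #|'I_k|.
  rewrite eqn_leq leq_image_card/= card_ord (leq_trans kx)//.
  apply: subset_leq_card; apply/fintype.subsetP => u _.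
  by have [i ->] := tuple_point_surj u; exact: fintype.image_f.
move=> /image_injP tI i j ij; apply: (tI i j) => //; exact: val_inj.
Qed.

Lemma index_complex_iso cplx index r : ball_complex cplx index ->
  injective (fun i => row i x) ->
  complex_iso (index k x (r / 2)) (cplx (tuple_points x) r).
Proof.
move=> [_ _ emb _ _] xI; exists tuple_point.
have tI : injective tuple_point.
  by move=> i j /(congr1 val)/= /xI.
split; last first.
  by have [] := emb (tuple_points x) r k x tuple_point tI (fun=> erefl).
apply: (inj_card_bij tI); rewrite -[leqRHS](card_codom tI).
apply: subset_leq_card; apply/fintype.subsetP => u _.
by have [i ->] := tuple_point_surj u; exact: codom_f.
Qed.

End tuple_points.

Lemma complex_iso_card (V W : finType) (K : complex V) (L : complex W) :
  complex_iso K L -> #|V| = #|W|.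
Proof. by move=> [h [hb _]]; exact: bij_eq_card hb. Qed.

Lemma graph_iso_card (V W : finType) (e : rel V) (f : rel W) :
  graph_iso e f -> #|V| = #|W|.
Proof. by move=> [h [hb _]]; exact: bij_eq_card hb. Qed.

Lemma rips_flag_iso (P : {fset 'rV[R]_d}) (V : finType) (e : rel V) :
  graph_iso (@geometric_graph R d P 1) e ->
  complex_iso (rips P 1) (flag_complex e).
Proof.
move=> [h [hb he]]; exists h; split => // s; rewrite !inE imset_eq0.
have hI := bij_inj hb.
congr (_ && _); apply/forall_inP/asboolP => [es u v us vs|es _ /imsetP[u us ->]].
  apply/eball_meetP; have [->|uv] := eqVneq u v; first by rewrite edistxx.
  have /forall_inP/(_ (h v) (imset_f h vs)) := es (h u) (imset_f h us).
  by rewrite (inj_eq hI) uv he => /andP[].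
apply/forall_inP => _ /imsetP[v vs ->]; apply/implyP; rewrite (inj_eq hI) => uv.
by rewrite he /geometric_graph uv; apply/eball_meetP; exact: es.
Qed.

End ball_complexes.

Section cluster_tuples.
Context (R : realType) (d : nat).

(** The points chosen near the rows of q are k distinct points of a set that has
    at most k points, hence are all of them. *)
Lemma cluster_event_tuple k (q : 'M[R]_(k, d)) (e s : R) (C : config R d) :
  (forall i j p, edist (row i q) p <= e -> edist (row j q) p <= e -> i = j) ->
  e <= s -> cluster_event q e s C ->
  exists x : 'M[R]_(k, d),
    [/\ forall i, config_points C (row i x),
        forall i, edist (row i q) (row i x) <= e,
        injective (fun i => row i x) &
        forall p, config_points C p -> eball_tuple q s p ->
          exists i, p = row i x].
Proof.
move=> qI es [Cq Cs].
have /choice[f fP] : forall i, exists p, config_points C p /\ edist (row i q) p <= e.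
  by move=> i; have [p [Cp qp]] := Cq i; exists p.
exists (\matrix_(i, j) f i 0 j).
have fE i : row i (\matrix_(i, j) f i 0 j) = f i by apply/rowP => j; rewrite !mxE.
have fI : injective f.
  by move=> i j ij; apply: (qI i j (f i)); rewrite ?(fP i).2// ij (fP j).2.
split.
- by move=> i; rewrite fE; exact: (fP i).1.
- by move=> i; rewrite fE; exact: (fP i).2.
- by move=> i j; rewrite !fE => /fI.
move=> p Cp qp.
have fin : finite_set (C `&` eball_tuple q s).
  exact/config_locally_finite/bounded_eball_tuple.
move: Cs; rewrite /config_count /counting asboolT// lee_fin ler_nat => Cs.
have sub : ([fset f i | i in 'I_k] `<=` fset_set (C `&` eball_tuple q s))%fset.
  apply/fsubsetP => _ /imfsetP[i _ ->]; rewrite in_fset_set// inE.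
  split; first exact: (fP i).1.
  by exists i => //; apply: le_trans es; exact: (fP i).2.
have : [fset f i | i in 'I_k]%fset == fset_set (C `&` eball_tuple q s).
  rewrite eqEfcard sub/=; apply: leq_trans Cs _.
  by rewrite card_imfset//= size_enum_ord.
move=> /eqP e1; have : p \in fset_set (C `&` eball_tuple q s).
  by rewrite in_fset_set// inE.
by rewrite -e1 => /imfsetP[i _ ->]; exists i; rewrite fE.
Qed.

End cluster_tuples.

(** * Clusters on a grid *)

Section gamma_clusters.
Context (R : realType) (d : nat) (disp : measure_display)
  (Omega : measurableType disp) (P : probability Omega R)
  (Phi : {mfun Omega >-> config R d}).
Variables (rho : forall k, 'M[R]_(k, d) -> R).
Variables (palm : forall k, R.-pker 'M[R]_(k, d) ~> config R d).
Variables (beta : R) (beta0 : 0 < beta).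
Hypotheses (irho : forall j, (0 < j)%N -> is_joint_intensity P Phi (@rho j))
  (trho : forall j, (0 < j)%N -> translation_invariant (@rho j))
  (ipalm : forall j, (0 < j)%N -> is_reduced_palm P Phi (@rho j) (palm j))
  (tpalm : forall j, (0 < j)%N -> translation_covariant (palm j)).

(** The isolated clusters of pattern y appear around q, hence by stationarity
    around every translate of q, with the same positive probability. *)
Definition recurrent_pattern j (b : R) (y : 'M[R]_(j, d)) :=
  exists (q : 'M[R]_(j, d)) (e : R), [/\ 0 < e, stable_near q e b y &
    (0 < P (Phi @^-1` cluster_event q e (b + 3 * e)))%E].

Lemma gamma_recurrent_pattern k : (0 < k)%N ->
  (0 < gamma rho palm beta (cross_polytope k))%E ->
  exists j (y : 'M[R]_(j.+1, d)), recurrent_pattern (beta `^ d%:R^-1) y /\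
    spherical (index_rips y (1 / 2)) k.
Proof.
move=> k0 g0; set m := #|{: 'I_k.+1 * bool}|.-1.
have cm : #|{: 'I_k.+1 * bool}| = m.+1 by rewrite /m card_prod card_ord card_bool.
have AI (y : 'M[R]_(m, d)) :
    graph_iso (@geometric_graph R d (tuple_points (with_origin y)) 1)
      (cross_polytope k) -> injective (fun i => row i (with_origin y)).
  by move=> /graph_iso_card yV; apply: tuple_points_inj; rewrite yV cm.
have [y [q [e [Ay e0 yq qP]]]] := cluster_event_gt0 beta0 (irho (ltn0Sn m))
  (trho (ltn0Sn m)) (ipalm (ltn0Sn m)) (tpalm (ltn0Sn m)) AI g0.
exists m, (with_origin y); split; first by exists q, e.
apply: (spherical_iso (index_complex_iso 1 (rips_ball_complex R d) (AI _ Ay))).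
exact: (spherical_iso (rips_flag_iso Ay)) (cross_polytope_spherical k0).
Qed.

Lemma gamma_cech_recurrent_pattern k : (0 < k)%N ->
  (0 < gamma_cech rho palm beta (hollow_simplex k.+2))%E ->
  exists j (y : 'M[R]_(j.+1, d)), recurrent_pattern (beta `^ d%:R^-1) y /\
    spherical (index_cech y (1 / 2)) k.
Proof.
move=> k0 g0; set m := #|'I_k.+2|.-1.
have cm : #|'I_k.+2| = m.+1 by rewrite /m card_ord.
have AI (y : 'M[R]_(m, d)) :
    complex_iso (cech (tuple_points (with_origin y)) 1) (hollow_simplex k.+2) ->
    injective (fun i => row i (with_origin y)).
  by move=> /complex_iso_card yV; apply: tuple_points_inj; rewrite yV cm.
have [y [q [e [Ay e0 yq qP]]]] := cluster_event_gt0 beta0 (irho (ltn0Sn m))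
  (trho (ltn0Sn m)) (ipalm (ltn0Sn m)) (tpalm (ltn0Sn m)) AI g0.
exists m, (with_origin y); split; first by exists q, e.
apply: (spherical_iso (index_complex_iso 1 (cech_ball_complex R d) (AI _ Ay))).
exact: (spherical_iso Ay) (hollow_simplex_spherical k0).
Qed.

End gamma_clusters.

Section grid.
Context (R : realType) (d : nat).

Lemma stable_near_shift k (q y : 'M[R]_(k, d)) e b z :
  stable_near q e b y -> stable_near (shift_tuple z q) e b y.
Proof.
move=> [st qI]; split.
  move=> x s qx sb S.
  have -> : x = shift_tuple z (1 *: shift_tuple (- z) x).
    by apply/matrixP => i j; rewrite !mxE mul1r addrNK.
  rewrite -[s / 2]mul1r; split.
    move=> /(balls_meet_shift_scale _ _ _ _ (@ltr01 R)).
    apply: (st _ s _ sb S).1 => i; have := qx i.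
    rewrite row_shift_tuple -(edistD z (row i q)) row_shift_tuple.
    by rewrite subrK.
  move=> yS; apply/balls_meet_shift_scale => //; move: yS.
  apply: (st _ s _ sb S).2 => i; have := qx i.
  rewrite row_shift_tuple -(edistD z (row i q)) row_shift_tuple.
  by rewrite subrK.
move=> i j p; rewrite !row_shift_tuple -[p](subrK z) !edistD; exact: qI.
Qed.

Lemma window_bounded n : bounded_set (@window R d n).
Proof.
by apply: (@bounded_set_coord _ _ _ _ (n%:R `^ d%:R^-1 / 2)) => x xn i j;
  rewrite (ord1 i); exact: xn.
Qed.

Lemma in_window_points (C : config R d) n x :
  (x \in window_points C n) <-> config_points C x /\ window n x.
Proof.
rewrite in_fset_set; last exact/config_locally_finite/window_bounded.
by rewrite inE.
Qed.

(** The grid starts at the corner of the cube of side L centred at the origin, and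
    M N <= L keeps its N^d cells of side M inside the cube. *)
Definition cell_center N (L M : R) (a : {ffun 'I_d -> 'I_N}) : 'rV[R]_d :=
  \row_j (- (L / 2) + M * (a j)%:R + M / 2).

Lemma cell_center_inj N (L M : R) (a a' : {ffun 'I_d -> 'I_N}) (p : 'rV[R]_d) :
  (forall j, `|p 0 j - cell_center L M a 0 j| < M / 2) ->
  (forall j, `|p 0 j - cell_center L M a' 0 j| < M / 2) -> a = a'.
Proof.
move=> pa pa'; apply/ffunP => j; apply/val_inj/eqP => /=.
have := pa j; have := pa' j; rewrite !mxE !ltr_norml => /andP[h1 h2] /andP[h3 h4].
have M0 : 0 < M by lra.
have lt_cell (u v : nat) : M * u%:R < M * v%:R + M -> (u <= v)%N.
  by rewrite -[X in _ + X]mulr1 -mulrDr ltr_pM2l// natr1 ltr_nat ltnS.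
by rewrite eqn_leq !lt_cell//; lra.
Qed.

(** Each cell in which the event occurs contains a cluster. Its points are within
    M / 2 of the centre of the cell in each coordinate, hence they are in the
    window and clusters of different cells are disjoint. Its pattern is that of
    y because r is within e of b. A point within r of the cluster is within
    e + r <= b + 2 e of q, hence belongs to the cluster. *)
Lemma grid_betti_ge (cplx : forall Q : {fset 'rV[R]_d}, R -> complex Q)
    (index : forall k, 'M[R]_(k, d) -> R -> complex 'I_k) k
    (q y : 'M[R]_(k, d)) (e b r M : R) n N l (C : config R d) :
  ball_complex cplx index -> 0 < e -> stable_near q e b y -> `|r - b| <= e ->
  (forall i j, `|q i j| + e < M / 2) -> M * N%:R <= n%:R `^ d%:R^-1 ->
  0 <= b ->
  (forall (V I : finType) (K : complex V) (g : I -> 'I_k -> V),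
    hereditary K -> (forall i, embeds K (index k y (1 / 2)) (g i)) ->
    (forall i, isolated K (g i @: finset.setT)%SET) ->
    (forall i j u v, g i u = g j v -> i = j) -> (#|I| <= betti K l)%N) ->
  (#|[set a : {ffun 'I_d -> 'I_N} | `[<
      cluster_event (shift_tuple (cell_center (n%:R `^ d%:R^-1) M a) q) e
        (b + 3 * e) C >]]%SET| <= betti (cplx (window_points C n) r) l)%N.
Proof.
move=> [her dist emb indexE _] e0 st rb qM MN b0 lower.
set L := n%:R `^ d%:R^-1; set A := [set a | _]%SET.
set Q := window_points C n.
have main (a : {a | a \in A}) : exists g : 'I_k -> Q,
    [/\ embeds (cplx Q r) (index k y (1 / 2)) g,
      isolated (cplx Q r) (g @: finset.setT)%SET &
      forall i j, `|val (g i) 0 j - cell_center L M (val a) 0 j| < M / 2].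
  case: a => a /= aA; set z := cell_center L M a.
  have Cz : cluster_event (shift_tuple z q) e (b + 3 * e) C.
    by apply/asboolP; move: aA; rewrite inE.
  have [stz zI] := stable_near_shift z st.
  have ees : e <= b + 3 * e by lra.
  have [x [Cx zx xI xonly]] := cluster_event_tuple zI ees Cz.
  have xcell i j : `|row i x 0 j - z 0 j| < M / 2.
    have zxj := le_trans (coord_le_edist _ _ j) (zx i).
    have zE : row i (shift_tuple z q) 0 j = q i j + z 0 j.
      by rewrite row_shift_tuple [LHS]mxE [X in X + _]mxE.
    apply: le_lt_trans (qM i j).
    have -> : row i x 0 j - z 0 j =
      q i j - (row i (shift_tuple z q) 0 j - row i x 0 j) by rewrite zE; ring.
    by rewrite (le_trans (ler_normB _ _))// lerD2l.
  have xQ i : row i x \in Q.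
    apply/in_window_points; split => // j; have := xcell i j.
    rewrite !mxE -/L ltr_norml ler_norml => /andP[h1 h2].
    have aN : (a j)%:R + 1 <= N%:R :> R by rewrite natr1 ler_nat.
    have a0 : 0 <= (a j)%:R :> R by [].
    have M0 : 0 < M by lra.
    have : M * ((a j)%:R + 1) <= M * N%:R by rewrite ler_pM2l.
    have : 0 <= M * (a j)%:R by rewrite mulr_ge0// ltW.
    rewrite mulrDr mulr1 -/L in MN * => p1 p2.
    by apply/andP; split; lra.
  pose g i : Q := FSetSub (xQ i).
  have gI : injective g by move=> i j /(congr1 val)/= /xI.
  exists g; split => //.
    have := emb Q r k x g gI (fun=> erefl).
    by rewrite (indexE _ x y (r / 2) (1 / 2) (stz x r zx rb)).
  move=> s sK v vs /imsetP[i _ vi]; apply/fintype.subsetP => u us.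
  have uv := dist Q r s v u sK vs us.
  have /in_window_points[Cu _] := fsvalP u.
  have [|i' ui'] := xonly (val u) Cu.
    exists i => //; apply: (le_trans (edist_triangle (row i x) _ _)).
    rewrite vi/= in uv; have := zx i.
    move: rb; rewrite ler_norml => /andP[_]; lra.
  by apply/imsetP; exists i' => //; exact: val_inj.
have /choice[g gP] := main.
rewrite -card_sig; apply: (lower _ _ _ g).
- exact: her.
- by move=> a; have [] := gP a.
- by move=> a; have [] := gP a.
- move=> a a' u v uv; apply/val_inj/(cell_center_inj (p := val (g a u))).
    by have [_ _] := gP a; apply.
  by rewrite uv; have [_ _] := gP a'; apply.
Qed.

End grid.

(** * Lower bound *)

Section expected_lower_bound.
Context (R : realType) (d : nat) (disp : measure_display)
  (Omega : measurableType disp) (P : probability Omega R)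
  (Phi : {mfun Omega >-> config R d}).

Lemma measurable_cluster_preimage k (q : 'M[R]_(k, d)) e s :
  measurable (Phi @^-1` cluster_event q e s).
Proof.
rewrite -[X in measurable X]setTI; apply: (measurable_funP Phi) => //.
exact: measurable_cluster_event.
Qed.

Lemma powR_root n : (0 < d)%N -> (n%:R `^ d%:R^-1 : R) ^+ d = n%:R.
Proof.
move=> d0; rewrite -powR_mulrn ?powR_ge0// -powRrM mulVf ?powRr1//.
by rewrite pnatr_eq0 -lt0n.
Qed.

(** N is the integral part of L / M, which is at least half of L / M as soon as
    L >= M. *)
Lemma grid_size_ge (M : R) (n : nat) : (0 < d)%N -> 0 < M ->
  M ^+ d <= n%:R ->
  exists N, M * N%:R <= n%:R `^ d%:R^-1 /\
    (2 * M) ^- d * n%:R <= (N ^ d)%:R :> R.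
Proof.
move=> d0 M0 Mn; set L := n%:R `^ d%:R^-1.
have L0 : 0 <= L by exact: powR_ge0.
have ML : M <= L.
  by rewrite -(@ler_pXn2r _ d) ?nnegrE ?(ltW M0)// /L powR_root.
have LM0 : 0 <= L / M by rewrite divr_ge0// ltW.
exists (Num.truncn (L / M)).
have /andP[t1 t2] := truncn_itv LM0.
split; first by rewrite mulrC -ler_pdivlMr.
have N1 : 1 <= (Num.truncn (L / M))%:R :> R.
  by rewrite ler1n truncn_gt0 ler_pdivlMr// mul1r.
rewrite -(powR_root n d0) -/L -exprVn -exprMn natrX.
apply: lerXn2r; rewrite ?nnegrE// ?mulr_ge0// ?invr_ge0 ?mulr_ge0 ?(ltW M0)//.
rewrite invfM -mulrA (mulrC M^-1) ler_pdivrMl//.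
by move: t2; rewrite -natr1; lra.
Qed.

(** The expected number of good cells is N^d times a constant probability; the
    halved constant makes the inequality strict. *)
Lemma expected_betti_ge (cplx : forall Q : {fset 'rV[R]_d}, R -> complex Q)
    (index : forall k, 'M[R]_(k, d) -> R -> complex 'I_k) k
    (y : 'M[R]_(k, d)) (b : R) (r : nat -> R) l :
  (0 < d)%N -> stationary P Phi -> ball_complex cplx index -> 0 < b ->
  r @ \oo --> b -> recurrent_pattern P Phi b y ->
  (forall (V I : finType) (K : complex V) (g : I -> 'I_k -> V),
    hereditary K -> (forall i, embeds K (index k y (1 / 2)) (g i)) ->
    (forall i, isolated K (g i @: finset.setT)%SET) ->
    (forall i j u v, g i u = g j v -> i = j) -> (#|I| <= betti K l)%N) ->
  exists2 c : R, 0 < c & \forall n \near \oo, ((c * n%:R)%:E <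
    'E_P[fun w => (betti (cplx (window_points (Phi w) n) (r n)) l)%:R])%E.
Proof.
move=> d0 sP bc b0 rb [q [e [e0 st pP]]] lower.
have [M M0 qM] : exists2 M : R, 0 < M & forall i j, `|q i j| + e < M / 2.
  exists (2 * (\sum_i \sum_j `|q i j| + e + 1)).
    have : 0 <= \sum_i \sum_j `|q i j|.
      by apply: sumr_ge0 => i _; exact: sumr_ge0.
    lra.
  move=> i j; have : `|q i j| <= \sum_i \sum_j `|q i j|.
    rewrite (bigD1 i)//= (bigD1 j)//= -addrA lerDl addr_ge0 ?sumr_ge0// => *.
    exact: sumr_ge0.
  lra.
set H := cluster_event q e (b + 3 * e) in pP.
pose p := fine (P (Phi @^-1` H)).
have pE : P (Phi @^-1` H) = p%:E.
  by rewrite /p fineK// fin_num_measure//; exact: measurable_cluster_preimage.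
have p0 : 0 < p by rewrite pE lte_fin in pP.
pose c0 := p * (2 * M) ^- d.
have c00 : 0 < c0 by rewrite mulr_gt0// invr_gt0 exprn_gt0// mulr_gt0.
exists (c0 / 2); first by rewrite divr_gt0.
have rbe : \forall n \near \oo, `|r n - b| <= e.
  by move/cvgrPdist_le : rb => /(_ e e0); apply: filterS => n; rewrite distrC.
have nM : \forall n \near \oo, M ^+ d <= n%:R :> R.
  by exists (Num.bound (M ^+ d)) => // n /= Mn; apply: ltW;
    apply: lt_le_trans (archi_boundP (exprn_ge0 _ (ltW M0))) _; rewrite ler_nat.
have n1 : \forall n \near \oo, (0 < n)%N by exists 1%N.
near=> n.
have n0 : (0 < n)%N by near: n.
have [N [MN Nn]] : exists N, M * N%:R <= n%:R `^ d%:R^-1 /\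
    (2 * M) ^- d * n%:R <= (N ^ d)%:R :> R.
  by apply: grid_size_ge => //; near: n.
have rne : `|r n - b| <= e by near: n.
pose z (a : {ffun 'I_d -> 'I_N}) := cell_center (n%:R `^ d%:R^-1) M a.
pose B a := Phi @^-1` cluster_event (shift_tuple (z a) q) e (b + 3 * e).
have mB a : measurable (B a) by exact: measurable_cluster_preimage.
have PB a : P (B a) = p%:E by rewrite /B stationary_cluster_event.
apply: (@lt_le_trans _ _ (\int[P]_w (\sum_(a : {ffun 'I_d -> 'I_N}) (\1_(B a) w)%:E))%E).
  rewrite ge0_integral_sum//; last first.
    by move=> a; apply/measurable_EFinP; exact: measurable_indic.
  rewrite (eq_bigr (fun=> p%:E)); last first.
    by move=> a _; rewrite integral_indic// setIT; exact: PB.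
  rewrite sumEFin sumr_const card_ffun !card_ord lte_fin -[X in _ < X]mulr_natl.
  apply: (@lt_le_trans _ _ (c0 * n%:R)).
    by rewrite ltr_pM2r ?ltr0n//; move: c00; clearbody c0; lra.
  by rewrite /c0 -mulrA mulrC ler_pM2r.
rewrite expectation.unlock; apply: ge0_le_lower_integral => w.
  by apply: sume_ge0 => a _; rewrite lee_fin.
have := grid_betti_ge (Phi w) bc e0 st rne qM MN (ltW b0) lower.
rewrite sumEFin lee_fin -(ler_nat R); apply: le_trans.
rewrite -sum1_card natr_sum [leRHS]big_mkcond/=.
apply: ler_sum => a _; rewrite indicE !inE.
case: asboolP => Ba; first by rewrite -[leRHS]/(1%:R); rewrite ler_nat leq_b1.
by rewrite memNset.
Unshelve. all: by end_near. Qed.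

End expected_lower_bound.

(** * Upper bound *)

Section expected_upper_bound.
Context (R : realType) (d : nat) (disp : measure_display)
  (Omega : measurableType disp) (P : probability Omega R)
  (Phi : {mfun Omega >-> config R d}).

Definition cube (z : 'rV[R]_d) (s : R) : set 'rV[R]_d :=
  [set x | forall j, `|x 0 j - z 0 j| <= s].

Definition npoints (C : config R d) (B : set 'rV[R]_d) : nat :=
  #|` fset_set (C `&` B)|.

Lemma cube_shift z w s : [set x | cube (z + w) s (x + w)] = cube z s.
Proof.
by apply/seteqP; split => x xz j; have := xz j; rewrite !mxE opprD addrACA subrr addr0.
Qed.

Lemma measurable_cube z s : measurable (cube z s).
Proof.
have -> : cube z s = \bigcap_(j in [set: 'I_d]) [set x | `|x 0 j - z 0 j| <= s].
  by apply/seteqP; split => x h j; [move=> _; exact: h|exact: (h j)].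
apply: fin_bigcap_measurable => // j _; apply: measurable_ler => //.
apply: measurableT_comp => //; apply: measurable_funB => //.
exact: measurable_coord.
Qed.

Lemma cube_coord_le z s : exists M, forall x, cube z s x -> forall j, `|x 0 j| <= M.
Proof.
exists (s + \sum_j `|z 0 j|) => x xz j.
rewrite -[x 0 j](subrK (z 0 j)) (le_trans (ler_normD _ _))// lerD//.
by rewrite (bigD1 j)//= lerDl sumr_ge0.
Qed.

Lemma bounded_cube z s : bounded_set (cube z s).
Proof.
have [M zM] := cube_coord_le z s.
by apply: (@bounded_set_coord _ _ _ _ M) => x xz i j; rewrite (ord1 i) zM.
Qed.

Lemma config_count_npoints C z s :
  config_count C (cube z s) = (npoints C (cube z s))%:R%:E.
Proof.
rewrite /config_count /counting asboolT//.
exact/config_locally_finite/bounded_cube.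
Qed.

Lemma npoints_shift z w s C :
  npoints (shift_config w C) (cube (z + w) s) = npoints C (cube z s).
Proof.
have := config_count_shift w C (cube (z + w) s).
rewrite cube_shift !config_count_npoints => /eqP.
by rewrite eqe eqr_nat => /eqP.
Qed.

Lemma measurable_npoints_eq z s n :
  measurable [set C | npoints C (cube z s) = n].
Proof.
rewrite [X in measurable X](_ : _ =
  (fun C : config R d => config_count C (cube z s)) @^-1` [set n%:R%:E]).
  rewrite -[X in measurable X]setTI; apply: measurable_config_count => //.
  exact: measurable_cube.
apply/seteqP; split => C /=; rewrite config_count_npoints; first by move=> ->.
by move=> [/eqP]; rewrite eqr_nat => /eqP.
Qed.

Lemma measurable_npoints z s :
  measurable_fun setT (fun C : config R d => npoints C (cube z s)).
Proof.
move=> _ Y _; rewrite setTI.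
have -> : (fun C => npoints C (cube z s)) @^-1` Y =
    \bigcup_(n in Y) [set C | npoints C (cube z s) = n].
  by apply/seteqP; split => [C YC|C [n Yn /= ->]//]; exists (npoints C (cube z s)).
by apply: bigcup_measurable => n _; exact: measurable_npoints_eq.
Qed.

Lemma measurable_npoints_Phi z s :
  measurable_fun setT (fun t => npoints (Phi t) (cube z s)).
Proof. exact: measurableT_comp (measurable_npoints z s) (measurable_funP Phi). Qed.

(** The number of points in a cube and in its translates have the same
    distribution. *)
Lemma integral_npoints_shift (F : nat -> R) z w s : stationary P Phi ->
  (forall n, 0 <= F n) ->
  (\int[P]_t (F (npoints (Phi t) (cube (z + w) s)))%:E =
   \int[P]_t (F (npoints (Phi t) (cube z s)))%:E)%E.
Proof.
move=> sP F0.
have mF : measurable_fun [set: nat] (fun n => (F n)%:E).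
  by apply/measurable_EFinP.
have e z' : (\int[P]_t (F (npoints (Phi t) (cube z' s)))%:E =
    \int[pushforward P (fun t => npoints (Phi t) (cube z' s))]_n (F n)%:E)%E.
  rewrite (ge0_integral_pushforward (measurable_npoints_Phi z' s))//.
  by move=> n _; rewrite lee_fin.
rewrite !e.
apply: eq_measure_integral => /= [||_ _ A _ _]; try exact: measurable_npoints_Phi.
rewrite /pushforward.
have mA : measurable [set C | A (npoints C (cube (z + w) s))].
  by rewrite -[X in measurable X]setTI; exact: measurable_npoints.
have := sP w _ mA; rewrite /preimage/= => <-.
by congr (P _); apply/seteqP; split => t /=; rewrite npoints_shift.
Qed.

(** The injective maps from k indices to the points of the cube are tuples of
    distinct points. *)
Lemma ffact_le_counting k C z s :
  (((npoints C (cube z s)) ^_ k)%:R%:E <=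
    counting (distinct_tuples k C `&` [set x | forall i, cube z s (row i x)])
    :> \bar R)%E.
Proof.
set D := _ `&` _; rewrite /counting; case: asboolP => fD; last exact: leey.
rewrite lee_fin ler_nat.
set F := fset_set (C `&` cube z s).
have fF : finite_set (C `&` cube z s).
  exact/config_locally_finite/bounded_cube.
pose T (f : {ffun 'I_k -> F}) : 'M[R]_(k, d) := \matrix_(i, j) val (f i) 0 j.
have Trow f i : row i (T f) = val (f i) by apply/rowP => j; rewrite !mxE.
have TI : injective T.
  move=> f g /(congr1 (fun x : 'M[R]_(k, d) => x)) fg; apply/ffunP => i.
  by apply: val_inj; rewrite -!Trow fg.
have TD (f : {ffun 'I_k -> F}) : injectiveb f -> T f \in fset_set D.
  move=> /injectiveP fI; rewrite in_fset_set// inE; split.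
    split => [i|i j]; rewrite ?Trow; last by move=> /val_inj/fI.
    by have := fsvalP (f i); rewrite in_fset_set// inE => -[].
  move=> i /=; rewrite Trow.
  by have := fsvalP (f i); rewrite in_fset_set// inE => -[].
have -> : npoints C (cube z s) = #|{: F}| by rewrite /npoints -/F cardfE.
rewrite -{1}(card_ord k) -card_inj_ffuns.
have <- : #|` [fset T f | f in [set f : {ffun 'I_k -> F} | injectiveb f]%SET]%fset|
    = #|[set f : {ffun 'I_k -> F} | injectiveb f]%SET|.
  by rewrite card_imfset//= -cardE.
apply: fsubset_leq_card; apply/fsubsetP => _ /imfsetP[f /= fi ->].
by apply: TD; rewrite inE in fi.
Qed.

Lemma integral_ffact_npoints_fin k z s (rho : 'M[R]_(k, d) -> R) :
  is_joint_intensity P Phi rho ->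
  (\int[P]_t (((npoints (Phi t) (cube z s)) ^_ k)%:R%:E) < +oo)%E.
Proof.
move=> [_ _ _ fin].
pose A : set 'M[R]_(k, d) := [set x | forall i, cube z s (row i x)].
have mA : measurable A.
  have -> : A = \bigcap_(i in [set: 'I_k]) [set x | cube z s (row i x)].
    by apply/seteqP; split => x h i; [move=> _; exact: h|exact: (h i)].
  apply: fin_bigcap_measurable => // i _.
  have := @measurable_row R k d i measurableT _ (measurable_cube z s).
  by rewrite setTI.
apply: le_lt_trans (fin A mA _).
  rewrite /factorial_moment; apply: ge0_le_lower_integral => t.
    by rewrite lee_fin.
  exact: ffact_le_counting.
have [M zM] := cube_coord_le z s.
apply: (@bounded_set_coord _ _ _ _ M) => x xA i j.
by have := zM _ (xA i) j; rewrite mxE.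
Qed.

(** A face is assigned to the cell of side 1 of one of its vertices, and the other
    vertices are within s of that one. *)
Lemma faces_le_cells (cplx : forall Q : {fset 'rV[R]_d}, R -> complex Q)
    (C : config R d) n (r s : R) k (L := n%:R `^ d%:R^-1 : R)
    (N := (Num.truncn L).+1) :
  (forall (Q : {fset 'rV[R]_d}) r s (u v : Q), s \in cplx Q r -> u \in s ->
    v \in s -> edist (val u) (val v) <= r) ->
  r <= s ->
  (#|faces (cplx (window_points C n) r) k| <=
   \sum_(a : {ffun 'I_d -> 'I_N})
     (npoints C (cube (cell_center L 1 a) (1 / 2 + s))) ^_ k.+1)%N.
Proof.
move=> dist rs; set Q := window_points C n.
have L0 : 0 <= L by exact: powR_ge0.
pose D (a : {ffun 'I_d -> 'I_N}) : {set Q} :=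
  [set u : Q | `[< cube (cell_center L 1 a) (1 / 2 + s) (val u) >]]%SET.
pose F a := [set S : {set Q} | S \subset D a & #|S| == k.+1]%SET.
have FE a : (#|F a| <= (npoints C (cube (cell_center L 1 a) (1 / 2 + s))) ^_ k.+1)%N.
  rewrite cards_draws; apply: (@leq_trans
    'C(npoints C (cube (cell_center L 1 a) (1 / 2 + s)), k.+1)).
    apply: leq_bin2l; rewrite cardE -(size_map val); apply: uniq_leq_size.
      by rewrite map_inj_uniq ?enum_uniq//; exact: val_inj.
    move=> x /mapP[u + ->]; rewrite mem_enum inE => /asboolP ua.
    have /in_window_points[Cu _] := fsvalP u.
    rewrite in_fset_set ?inE//.
    exact/config_locally_finite/bounded_cube.
  by rewrite -bin_ffact leq_pmulr// fact_gt0.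
apply: (@leq_trans (\sum_(a : {ffun 'I_d -> 'I_N}) #|F a|)%N); last first.
  by apply: leq_sum => a _; exact: FE.
rewrite -sum1_card.
have cov S : S \in faces (cplx Q r) k ->
    (1 <= \sum_(a : {ffun 'I_d -> 'I_N}) (S \in F a : nat))%N.
  rewrite inE => /andP[SK cS].
  have /card_gt0P[v vS] : (0 < #|S|)%N by rewrite (eqP cS).
  have /in_window_points[_ vw] := fsvalP v.
  have vL j : 0 <= val v 0 j + L / 2.
    by have := vw j; rewrite -/L ler_norml => /andP[h _]; lra.
  have vN j : (Num.truncn (val v 0 j + L / 2)%R < N)%N.
    rewrite ltnS; apply: le_truncn.
    by have := vw j; rewrite -/L ler_norml => /andP[_ h]; lra.
  pose a : {ffun 'I_d -> 'I_N} := [ffun j => Ordinal (vN j)].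
  suff Sa : S \in F a by rewrite (bigD1 a)//= Sa.
  rewrite inE cS andbT; apply/fintype.subsetP => u uS; rewrite inE.
  apply/asboolP => j; rewrite !mxE ffunE/= mul1r.
  have := dist _ _ _ _ _ SK uS vS; have := coord_le_edist (val u) (val v) j.
  have /andP[t1] := truncn_itv (vL j); rewrite -[ltRHS]natr1.
  move: t1; move: ((Num.truncn _)%:R : R) => t t1 t2 uv uvr.
  have := le_trans uv (le_trans uvr rs).
  move: t1 t2; move: (val u 0 j : R) (val v 0 j : R) => pu pv t1 t2.
  by rewrite !ler_norml => /andP[h1 h2]; apply/andP; split; lra.
apply: (@leq_trans (\sum_(S in faces (cplx Q r) k)
    \sum_(a : {ffun 'I_d -> 'I_N}) (S \in F a : nat))%N).
  exact: leq_sum.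
rewrite exchange_big/=; apply: leq_sum => a _.
rewrite -sum1_card [leqRHS]big_mkcond/= [leqLHS]big_mkcond/=.
by apply: leq_sum => S _; case: ifP => // _; case: (S \in F a).
Qed.

Lemma expected_betti_le (cplx : forall Q : {fset 'rV[R]_d}, R -> complex Q)
    (index : forall k, 'M[R]_(k, d) -> R -> complex 'I_k) k
    (rho : 'M[R]_(k.+1, d) -> R) (r : nat -> R) (s : R) :
  (0 < d)%N -> stationary P Phi -> is_joint_intensity P Phi rho ->
  ball_complex cplx index -> (\forall n \near \oo, r n <= s) ->
  exists2 c : R, 0 < c & \forall n \near \oo,
    ('E_P[fun w => (betti (cplx (window_points (Phi w) n) (r n)) k)%:R] <
    (c * n%:R)%:E)%E.
Proof.
move=> d0 sP irho [_ dist _ _ _] rs.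
pose f (z : 'rV[R]_d) (t : Omega) : R :=
  ((npoints (Phi t) (cube z (1 / 2 + s))) ^_ k.+1)%:R.
have mf z : measurable_fun setT (f z).
  have m2 : measurable_fun [set: nat] (fun n : nat => (n ^_ k.+1)%:R : R) by [].
  exact: measurableT_comp m2 (measurable_npoints_Phi z _).
have fE z : (\int[P]_t (f z t)%:E = \int[P]_t (f 0 t)%:E)%E.
  rewrite -[z](add0r z).
  exact: (@integral_npoints_shift (fun n => (n ^_ k.+1)%:R)).
pose m0 := fine (\int[P]_t (f 0 t)%:E).
have fm0 z : (\int[P]_t (f z t)%:E = m0%:E)%E.
  rewrite fE /m0 fineK// ge0_fin_numE.
    exact: integral_ffact_npoints_fin irho.
  by apply: integral_ge0 => t _; rewrite lee_fin.
have m00 : 0 <= m0.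
  by rewrite -lee_fin -(fm0 0) integral_ge0// => t _; rewrite lee_fin.
exists (2 ^+ d * m0 + 1); first by rewrite ltr_wpDl// mulr_ge0.
have n1 : \forall n \near \oo, (0 < n)%N by exists 1%N.
near=> n.
have n0 : (0 < n)%N by near: n.
have rns : r n <= s by near: n.
set L := n%:R `^ d%:R^-1 : R; set N := (Num.truncn L).+1.
have LE : L ^+ d = n%:R by exact: powR_root.
have L1 : 1 <= L.
  by rewrite -(@ler_pXn2r _ d) ?nnegrE ?powR_ge0// LE expr1n ler1n.
apply: (@le_lt_trans _ _ (\int[P]_t
    (\sum_(a : {ffun 'I_d -> 'I_N}) (f (cell_center L 1 a) t)%:E))%E).
  rewrite expectation.unlock; apply: ge0_le_lower_integral => t.
    by rewrite lee_fin.
  rewrite sumEFin lee_fin -natr_sum ler_nat.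
  by apply: leq_trans (betti_le_faces _ _) _; exact: faces_le_cells.
rewrite ge0_integral_sum//; first last.
- by move=> a t _; rewrite lee_fin.
- by move=> a; apply/measurable_EFinP; exact: mf.
rewrite (eq_bigr (fun=> m0%:E)); last by move=> a _; exact: fm0.
rewrite sumEFin sumr_const card_ffun !card_ord lte_fin -[X in X < _]mulr_natl.
have NL : (N ^ d)%:R <= 2 ^+ d * n%:R :> R.
  rewrite -LE -exprMn natrX; apply: lerXn2r; rewrite ?nnegrE// ?mulr_ge0//.
    exact: powR_ge0.
  have /andP[t1 _] := truncn_itv (le_trans ler01 L1).
  by rewrite /N -natr1; lra.
rewrite mulrDl mul1r; apply: (@le_lt_trans _ _ (2 ^+ d * n%:R * m0)).
  exact: ler_wpM2r.
by rewrite mulrAC ltrDl ltr0n.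
Unshelve. all: by end_near. Qed.

End expected_upper_bound.

(** * Growth of the Betti numbers *)

Lemma cvg_root (R : realType) (d : nat) (r : nat -> R) (beta : R) :
  (0 < d)%N -> 0 < beta -> (forall n, 0 <= r n) ->
  (fun n => r n ^+ d) @ \oo --> beta -> r @ \oo --> beta `^ d%:R^-1.
Proof.
move=> d0 beta0 r0 rb; set b := beta `^ d%:R^-1.
have b0 : 0 < b by rewrite powR_gt0.
have bd : b ^+ d = beta.
  rewrite -powR_mulrn ?powR_ge0// -powRrM mulVf ?powRr1 ?(ltW beta0)//.
  by rewrite pnatr_eq0 -lt0n.
apply/cvgrPdist_le => e e0.
have up : \forall n \near \oo, r n ^+ d <= (b + e) ^+ d.
  apply: (cvgr_le _ rb).
  by rewrite -bd ltr_pXn2r// ?nnegrE ?ltW ?addr_gt0// ltrDl.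
have lo : \forall n \near \oo, b - e <= r n.
  have [be|be] := leP (b - e) 0.
    by apply: nearW => n; exact: le_trans be (r0 n).
  have : \forall n \near \oo, (b - e) ^+ d <= r n ^+ d.
    apply: (cvgr_ge _ rb).
    by rewrite -bd ltr_pXn2r// ?nnegrE ?ltW// gtrBl.
  by apply: filterS => n; rewrite ler_pXn2r// ?nnegrE// ltW.
near=> n.
have h1 : b - e <= r n by near: n.
have h2 : r n <= b + e.
  have be0 : 0 <= b + e by rewrite addr_ge0 ?ltW.
  by rewrite -(@ler_pXn2r _ d) ?nnegrE//; near: n.
by rewrite ler_norml; apply/andP; split; lra.
Unshelve. all: by end_near. Qed.

Theorem theorem4p2 (R : realType) (d : nat) (d_gt0 : (0 < d)%N)
    (disp : measure_display) (Omega : measurableType disp)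
    (P : probability Omega R) (Phi : {mfun Omega >-> config R d})
    (rho : forall k : nat, 'M[R]_(k, d) -> R)
    (palm : forall k : nat, R.-pker 'M[R]_(k, d) ~> config R d)
    (r : nat -> R) (beta : R)
    (Phi_stationary : stationary P Phi)
    (rho_intensity : forall j, (0 < j)%N -> is_joint_intensity P Phi (rho j))
    (rho_invariant : forall j, (0 < j)%N -> translation_invariant (rho j))
    (palm_reduced : forall j, (0 < j)%N ->
       is_reduced_palm P Phi (rho j) (palm j))
    (palm_covariant : forall j, (0 < j)%N -> translation_covariant (palm j))
    (unit_intensity : forall x, rho 1%N x = 1)
    (rho_continuous : forall j, (0 < j)%N -> ae_continuous (rho j))
    (r_ge0 : forall n, 0 <= r n)
    (beta_gt0 : 0 < beta)
    (r_beta : (fun n => r n ^+ d) @ \oo --> beta)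
    (gamma_cech_gt0 : forall k, (1 <= k < d)%N ->
       (0 < gamma_cech rho palm beta (hollow_simplex k.+2))%E)
    (gamma_gt0 : forall k, (1 <= k)%N ->
       (0 < gamma rho palm beta (cross_polytope k))%E) :
  (forall k, big_theta
     (fun n => ('E_P[fun w =>
        (betti (rips (window_points (Phi w) n) (r n)) k)%:R])%E)
     (fun n => n%:R)) /\
  (forall k, (k < d)%N -> big_theta
     (fun n => ('E_P[fun w =>
        (betti (cech (window_points (Phi w) n) (r n)) k)%:R])%E)
     (fun n => n%:R)).
Proof.
set b := beta `^ d%:R^-1.
have b0 : 0 < b by rewrite powR_gt0.
have rb : r @ \oo --> b by exact: cvg_root.
have rb1 : \forall n \near \oo, r n <= b + 1.
  by apply: (cvgr_le _ rb); rewrite ltrDl.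
have theta (cplx : forall Q : {fset 'rV[R]_d}, R -> complex Q)
    (index : forall k, 'M[R]_(k, d) -> R -> complex 'I_k) k j
    (y : 'M[R]_(j, d)) : ball_complex cplx index -> recurrent_pattern P Phi b y ->
    (forall (V I : finType) (K : complex V) (g : I -> 'I_j -> V),
      hereditary K -> (forall i, embeds K (index j y (1 / 2)) (g i)) ->
      (forall i, isolated K (g i @: finset.setT)%SET) ->
      (forall i j u v, g i u = g j v -> i = j) -> (#|I| <= betti K k)%N) ->
    big_theta (fun n => ('E_P[fun w =>
      (betti (cplx (window_points (Phi w) n) (r n)) k)%:R])%E) (fun n => n%:R).
  move=> bc rec lower.
  have [c c0 cE] := expected_betti_ge d_gt0 Phi_stationary bc b0 rb rec lower.
  have [C C0 CE] := expected_betti_le d_gt0 Phi_stationary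
    (rho_intensity k.+1 isT) bc rb1.
  exists c, C; split => //; near=> n; apply/andP; split; first by near: n.
  by near: n.
(* The 4-cycles isolated from the other points serve in degree 0. *)
have [j1 [y1 [rec1 _]]] := gamma_recurrent_pattern beta_gt0 rho_intensity
  rho_invariant palm_reduced palm_covariant (ltn0Sn 0) (gamma_gt0 1%N isT).
have half : 0 <= 1 / 2 :> R by [].
have betti0 cplx index : ball_complex cplx index -> big_theta (fun n =>
    ('E_P[fun w => (betti (cplx (window_points (Phi w) n) (r n)) 0)%:R])%E)
    (fun n => n%:R).
  move=> bc; apply: (theta _ _ _ _ y1 bc rec1) => V I K g hK gL gA gdisj.
  have [_ _ _ _ vertex] := bc.
  exact: (betti0_ge_embedded hK (vertex _ y1 ord0 _ half) gL gA gdisj).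
split=> [[|k]|[|k] kd].
- exact/betti0/rips_ball_complex.
- have [j [y [rec sph]]] := gamma_recurrent_pattern beta_gt0 rho_intensity
    rho_invariant palm_reduced palm_covariant (ltn0Sn k) (gamma_gt0 k.+1 isT).
  apply: (theta _ _ _ _ y (rips_ball_complex R d) rec) => V I K g hK.
  exact: betti_ge_spheres.
- exact/betti0/cech_ball_complex.
- have [j [y [rec sph]]] := gamma_cech_recurrent_pattern beta_gt0 rho_intensity
    rho_invariant palm_reduced palm_covariant (ltn0Sn k) (gamma_cech_gt0 k.+1 kd).
  apply: (theta _ _ _ _ y (cech_ball_complex R d) rec) => V I K g hK.
  exact: betti_ge_spheres.
Unshelve. all: by end_near. Qed.
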